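(* There exist badly approximable extremal real numbers which are not conjugate under the action of $\mathrm{GL}_2(\mathbb{Q})$ by linear fractional transformations to any extremal real number having an associated Fibonacci sequence contained in $\mathrm{GL}_2(\mathbb{Z})$.
   Context: Let $\gamma=(1+\sqrt5)/2$. A real number $\xi$ is extremal if it is neither rational nor quadratic over $\mathbb{Q}$ and there is $c>0$ such that for every $X\ge1$ the system $|x_0|\le X$, $|x_0\xi-x_1|\le cX^{-1/\gamma}$, $|x_0\xi^2-x_2|\le cX^{-1/\gamma}$ has a non-zero integer solution. It is badly approximable if there is $c>0$ with $|\xi-p/q|>cq^{-2}$ for all rationals $p/q$. ${\mathcal{P}}$ is the set of primitive (entries with gcd 1) integer $2\times2$ matrices with non-zero determinant, a group under $A*B=(AB)^{\mathrm{red}}$, where $C^{\mathrm{red}}$ is $C$ divided by the positive gcd of its entries. A Fibonacci sequence in ${\mathcal{P}}$ satisfies $W_{i+2}=W_{i+1}*W_i$; it is admissible if there is $N\in{\mathcal{P}}$, neither symmetric nor skew-symmetric, with $W_iN_i$ symmetric for all $i$, where $N_i={}^tN$ for odd $i$, $N_i=N$ for even $i$. With $\|A\|$ the max absolute value of entries, $(W_i)$ is associated to $\xi$ if it is unbounded, admissible and $\|W_{i+1}\|\asymp\|W_i\|^\gamma$, $\|(\xi,-1)W_i\|\asymp\|W_i\|^{-1}$, $|\det W_i|\asymp1$ with constants independent of $i$. *)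

(* Defs.v *)
From HB Require Import structures.
From mathcomp Require Import all_boot all_order all_algebra.
From mathcomp Require Import all_classical all_reals all_analysis.

Set Implicit Arguments.
Unset Strict Implicit.
Unset Printing Implicit Defensive.

Import Order.TTheory GRing.Theory Num.Theory.
Import numFieldNormedType.Exports.

Local Open Scope ring_scope.

Definition golden (R : realType) : R := (1 + Num.sqrt 5) / 2.

Definition rational (R : realType) (xi : R) : Prop :=
  exists q : rat, xi = ratr q.

Definition quadratic (R : realType) (xi : R) : Prop :=
  exists p : {poly rat},
    [/\ size p = 3%N, irreducible_poly p & root (map_poly ratr p) xi].

Definition extremal (R : realType) (xi : R) : Prop :=
  [/\ ~ rational xi, ~ quadratic xi &
    exists2 c : R, 0 < c &
      forall X : R, 1 <= X ->
        exists x0 x1 x2 : int,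
          [/\ (x0, x1, x2) <> (0, 0, 0),
              `|x0%:~R| <= X,
              `|x0%:~R * xi - x1%:~R| <= c * X `^ (- (golden R)^-1) &
              `|x0%:~R * xi ^+ 2 - x2%:~R| <= c * X `^ (- (golden R)^-1)]].

Definition badly_approximable (R : realType) (xi : R) : Prop :=
  exists2 c : R, 0 < c &
    forall p q : int, q != 0 ->
      c * q%:~R ^- 2 < `|xi - p%:~R / q%:~R|.

Definition content (A : 'M[int]_2) : nat :=
  \big[gcdn/0%N]_(ij : 'I_2 * 'I_2) `|A ij.1 ij.2|%N.

Definition mxred (A : 'M[int]_2) : 'M[int]_2 :=
  map_mx (fun a => (a %/ (content A)%:Z)%Z) A.

Definition starmx (A B : 'M[int]_2) : 'M[int]_2 := mxred (A *m B).

Definition inP (A : 'M[int]_2) : Prop := content A = 1%N /\ \det A != 0.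

Definition symmetric_mx (A : 'M[int]_2) : Prop := A^T = A.

Definition skew_symmetric_mx (A : 'M[int]_2) : Prop := A^T = - A.

(* Sequences are indexed from 0. Starting the index at 1 instead only exchanges
   N and its transpose in the definition of admissibility. *)
Definition fibonacci (W : nat -> 'M[int]_2) : Prop :=
  (forall i, inP (W i)) /\ (forall i, W i.+2 = starmx (W i.+1) (W i)).

Definition admissible (W : nat -> 'M[int]_2) : Prop :=
  exists N : 'M[int]_2,
    [/\ inP N, ~ symmetric_mx N, ~ skew_symmetric_mx N &
      forall i, symmetric_mx (W i *m (if odd i then N^T else N))].

Definition asymp (R : realType) (f g : nat -> R) : Prop :=
  exists c1 c2 : R,
    [/\ 0 < c1, 0 < c2 & forall i, c1 * g i <= f i <= c2 * g i].

(* The norm on real matrices is the library's one: the largest absolute value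
   of an entry. *)
Definition norm_int_mx (R : realType) (A : 'M[int]_2) : R :=
  `|map_mx intr A : 'M[R]_2|.

Definition approx_row (R : realType) (xi : R) : 'rV[R]_2 :=
  \row_(j < 2) (if j == 0 then xi else -1).

Definition associated (R : realType) (W : nat -> 'M[int]_2) (xi : R) : Prop :=
  [/\ fibonacci W, admissible W &
    [/\ forall B : R, exists i, B < norm_int_mx R (W i),
        asymp (fun i => norm_int_mx R (W i.+1))
              (fun i => norm_int_mx R (W i) `^ golden R),
        asymp (fun i => `|approx_row xi *m map_mx intr (W i)|)
              (fun i => (norm_int_mx R (W i))^-1) &
        asymp (fun i => `|\det (W i)|%:~R) (fun=> 1 : R)]].

Definition linear_fractional (R : realType) (A : 'M[rat]_2) (xi : R) : R :=
  (ratr (A 0 0) * xi + ratr (A 0 1)) / (ratr (A 1 0) * xi + ratr (A 1 1)).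

(* Inversion being total, the value at a pole is a junk value, but an irrational
   xi is never a pole of an invertible rational matrix. *)
Definition GL2Q_conjugate (R : realType) (xi eta : R) : Prop :=
  exists2 A : 'M[rat]_2, A \in unitmx & eta = linear_fractional A xi.

(* Main.v *)
(* Write s for the square root of 2 and G(b) for [[s (1 + b), 1], [1, 0]]. The
   products of the G(b) along a word are integer matrices up to conjugation by
   diag(1, s) and, for words of odd length, division by s. Take the infinite
   Fibonacci word in b = 0, 1, let t be the real number whose continued fraction
   has the partial quotients s (1 + b), and put xi = t / s. The usual continued
   fraction of xi has the partial quotients 1 + b, every second one doubled, so xi
   is badly approximable.
   The palindromic prefixes of the word give symmetric matrices, hence integer
   points (x0, x1, x2) making xi extremal, and their determinants have absolute
   values 2, 1, 1, 2, 1, 1, ... up to a shift, since one length in three is even.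

   Points approximating an extremal number this well are essentially unique. If eta
   is conjugate to xi and (W_i) is associated to eta, transporting the points of xi
   to eta gives, from some point on, multiples of the points W_i N_i, all of whose
   determinants are +-det N when the W_i are unimodular. Then 2 would be a square
   up to sign. *)

Require Import Defs.
From mathcomp Require Import all_boot all_order all_algebra.
From mathcomp Require Import all_classical all_reals all_analysis.
From mathcomp Require Import ring lra zify.

Set Implicit Arguments.
Unset Strict Implicit.
Unset Printing Implicit Defensive.

Import Order.TTheory GRing.Theory Num.Theory.
Import numFieldNormedType.Exports.

Local Open Scope ring_scope.

(** * Symmetric 2 x 2 matrices as points *)

Lemma mulmx2E (T : comNzRingType) m n (A : 'M[T]_(m, 2)) (B : 'M[T]_(2, n)) i j :
  (A *m B) i j = A i 0 * B 0 j + A i 1 * B 1 j.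
Proof.
rewrite mxE !big_ord_recl big_ord0 addr0.
by have -> : lift ord0 ord0 = 1 :> 'I_2 by apply/val_inj.
Qed.

Lemma det_mx2 (T : comNzRingType) (A : 'M[T]_2) :
  \det A = A 0 0 * A 1 1 - A 0 1 * A 1 0.
Proof.
rewrite (expand_det_row _ 0) !big_ord_recl big_ord0 addr0.
have -> : lift ord0 ord0 = 1 :> 'I_2 by apply/val_inj.
rewrite /cofactor !det_mx11 !mxE /= !(addn0, expr0, expr1) mul1r mulN1r mulrN.
have -> : lift ord0 ord0 = 1 :> 'I_2 by apply/val_inj.
by have -> : lift (1 : 'I_2) (0 : 'I_1) = 0 by apply/val_inj.
Qed.

Lemma ord2P (i : 'I_2) : i = 0 \/ i = 1.
Proof. by case: i => [[|[|//]] ?]; [left|right]; apply/val_inj. Qed.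

Lemma mx2P (T : Type) (A B : 'M[T]_2) :
  A 0 0 = B 0 0 -> A 0 1 = B 0 1 -> A 1 0 = B 1 0 -> A 1 1 = B 1 1 -> A = B.
Proof.
by move=> ? ? ? ?; apply/matrixP => i j; case: (ord2P i) (ord2P j) => -> [] ->.
Qed.

Section Det3.
Variable T : comNzRingType.
Implicit Types x y z K : 'M[T]_2.

(* A symmetric matrix [[x0, x1], [x1, x2]] stands for the point (x0, x1, x2). *)
Definition det3 x y z : T :=
    x 0 0 * (y 0 1 * z 1 1 - y 1 1 * z 0 1)
  - x 0 1 * (y 0 0 * z 1 1 - y 1 1 * z 0 0)
  + x 1 1 * (y 0 0 * z 0 1 - y 0 1 * z 0 0).

(* The antisymmetric part of K obstructs the dependence of x, y and y K x. *)
Lemma det3_mul x y K : x 1 0 = x 0 1 -> y 1 0 = y 0 1 ->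
  (y *m K *m x) 1 0 = (y *m K *m x) 0 1 ->
  det3 x y (y *m K *m x) = \det x * \det y * (K 1 0 - K 0 1).
Proof.
move=> hx hy; rewrite /det3 !mulmx2E !det_mx2 hx hy.
move/eqP; rewrite -subr_eq0 => /eqP h; apply/eqP; rewrite -subr_eq0; apply/eqP.
transitivity (0 * (x 0 1 * y 0 1 - x 1 1 * y 0 0)); last by rewrite mul0r.
by rewrite -h; ring.
Qed.

(** The cross product of x ^ y and y ^ z is [D] times y. Taking the cross product of w with it and
    expanding the triple product gives the three identities: two distinct planes through y share
    only the line of y. *)
Lemma det3_proportional x y z w :
  det3 y z w = 0 -> det3 x y w = 0 ->
  let D := det3 x y z in
  [/\ D * (w 0 0 * y 0 1 - w 0 1 * y 0 0) = 0,
      D * (w 0 0 * y 1 1 - w 1 1 * y 0 0) = 0 &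
      D * (w 0 1 * y 1 1 - w 1 1 * y 0 1) = 0].
Proof.
move=> yzw xyw D.
have E (p q : T) :
    q * det3 y z w - p * det3 x y w = 0 by rewrite xyw yzw !mulr0 subrr.
split.
- rewrite -(E (y 0 0 * z 0 1 - y 0 1 * z 0 0) (x 0 0 * y 0 1 - x 0 1 * y 0 0)).
  by rewrite /D /det3; ring.
- rewrite -(E (y 0 0 * z 1 1 - y 1 1 * z 0 0) (x 0 0 * y 1 1 - x 1 1 * y 0 0)).
  by rewrite /D /det3; ring.
rewrite -(E (y 0 1 * z 1 1 - y 1 1 * z 0 1) (x 0 1 * y 1 1 - x 1 1 * y 0 1)).
by rewrite /D /det3; ring.
Qed.
End Det3.

(** * Matrices of words *)

Section Words.
Variable R : realType.

Local Notation s := (Num.sqrt 2 : R).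

Lemma sqr_sqrt2 : s * s = 2.
Proof. by rewrite -expr2 sqr_sqrtr. Qed.

Lemma sqrt2_gt0 : 0 < s.
Proof. by rewrite sqrtr_gt0. Qed.

Lemma sqrt2_bounds : 1 < s < 3 / 2.
Proof.
have := sqr_sqrt2; have := sqrt2_gt0; move: s => t t0 tt.
by apply/andP; split; nra.
Qed.

Lemma sqrt2_neq0 : s != 0.
Proof. exact: lt0r_neq0 sqrt2_gt0. Qed.

Definition letter (b : bool) : 'M[R]_2 :=
  \matrix_(i, j) if (i == 0) && (j == 0) then s * (1 + b%:R)
                 else if (i == 1) && (j == 1) then 0 else 1.

Definition wordmx (u : seq bool) : 'M[R]_2 :=
  foldr (fun b M => letter b *m M) 1%:M u.

Lemma letter_tr b : (letter b)^T = letter b.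
Proof. by apply/matrixP => i j; rewrite !mxE ![(j == _) && _]andbC. Qed.

Lemma wordmx_cat u v : wordmx (u ++ v) = wordmx u *m wordmx v.
Proof. by elim: u => [|b u IH] /=; rewrite ?mul1mx // IH mulmxA. Qed.

Lemma wordmx_rev u : wordmx (rev u) = (wordmx u)^T.
Proof.
elim: u => [|b u IH] /=; first by rewrite trmx1.
by rewrite rev_cons -cats1 wordmx_cat IH /= mulmx1 trmx_mul letter_tr.
Qed.

Lemma wordmx_cons0 b u j :
  wordmx (b :: u) 0 j = s * (1 + b%:R) * wordmx u 0 j + wordmx u 1 j.
Proof. by rewrite /= mulmx2E !mxE /= mul1r. Qed.

Lemma wordmx_cons1 b u j : wordmx (b :: u) 1 j = wordmx u 0 j.
Proof. by rewrite /= mulmx2E !mxE /= mul1r mul0r addr0. Qed.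

Lemma wordmx_trE u i j : wordmx u i j = wordmx (rev u) j i.
Proof. by rewrite wordmx_rev mxE. Qed.

Lemma normr_det_wordmx u : `|\det (wordmx u)| = 1.
Proof.
elim: u => [|b u IH]; first by rewrite /= det1 normr1.
by rewrite /= det_mulmx normrM IH mulr1 det_mx2 !mxE /= mulr0 mulr1 sub0r normrN normr1.
Qed.

Lemma wordmx_ge0 u i j : 0 <= wordmx u i j.
Proof.
elim: u i j => [|b u IH] i j; first by rewrite /= mxE ler0n.
case: (ord2P i) => ->; rewrite (wordmx_cons0, wordmx_cons1) //.
by rewrite addr_ge0 // mulr_ge0 // mulr_ge0 ?sqrtr_ge0 // addr_ge0.
Qed.

Lemma coef_bounds (b : bool) : 1 <= s * (1 + b%:R) <= 3.
Proof.
have /andP[s1 s2] := sqrt2_bounds.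
by case: b; rewrite ?mulr1n ?mulr0n; apply/andP; split; move: s s1 s2 => t ? ?; lra.
Qed.

Lemma wordmx_row_le0 u : wordmx u 1 0 <= wordmx u 0 0.
Proof.
case: u => [|b u]; first by rewrite /= !mxE.
rewrite wordmx_cons0 wordmx_cons1.
have /andP[c1 _] := coef_bounds b.
by have := wordmx_ge0 u 0 0; have := wordmx_ge0 u 1 0; nra.
Qed.

Lemma wordmx_row_le1 u : u != [::] -> wordmx u 1 1 <= wordmx u 0 1.
Proof.
case: u => [//|b u] _; rewrite wordmx_cons0 wordmx_cons1.
have /andP[c1 _] := coef_bounds b.
by have := wordmx_ge0 u 0 1; have := wordmx_ge0 u 1 1; nra.
Qed.

Lemma wordmx_row_ge0 u : u != [::] -> wordmx u 0 0 <= 4 * wordmx u 1 0.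
Proof.
case: u => [//|b u] _; rewrite wordmx_cons0 wordmx_cons1.
have /andP[_ c1] := coef_bounds b.
by have := wordmx_ge0 u 0 0; have := wordmx_row_le0 u; nra.
Qed.

Lemma wordmx_row_ge1 u : (1 < size u)%N -> wordmx u 0 1 <= 4 * wordmx u 1 1.
Proof.
case: u => [//|b u] su; rewrite wordmx_cons0 wordmx_cons1.
have /wordmx_row_le1 h : u != [::] by case: u su.
have /andP[_ c1] := coef_bounds b.
by have := wordmx_ge0 u 0 1; nra.
Qed.

Lemma rev_neq_nil (u : seq bool) : (rev u != [::]) = (u != [::]).
Proof. by rewrite -!size_eq0 size_rev. Qed.

Lemma wordmx_col_le0 u : wordmx u 0 1 <= wordmx u 0 0.
Proof. by rewrite !(wordmx_trE u) wordmx_row_le0. Qed.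

Lemma wordmx_col_ge0 u : u != [::] -> wordmx u 0 0 <= 4 * wordmx u 0 1.
Proof. by rewrite !(wordmx_trE u) -rev_neq_nil => /wordmx_row_ge0. Qed.

Lemma wordmx_le00 u i j : wordmx u i j <= wordmx u 0 0.
Proof.
have [->|u0] := eqVneq u [::]; first by rewrite /= !mxE /=; case: eqP.
case: (ord2P i) (ord2P j) => -> [] -> //; last 1 first.
- exact: le_trans (wordmx_row_le1 u0) (wordmx_col_le0 _).
- exact: wordmx_col_le0.
exact: wordmx_row_le0.
Qed.

(** The partial quotients lie in [1, 3], so each comparison of neighbouring entries costs a factor 3
    + 1 = 4, and at most two comparisons are chained. A single letter has a zero in its last entry,
    whence the condition on the length. *)
Lemma wordmx_ge00 u j : (1 < size u)%N -> wordmx u 0 0 <= 16 * wordmx u 1 j.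
Proof.
move=> su; have u0 : u != [::] by case: u su.
case: (ord2P j) => ->.
  by have := wordmx_row_ge0 u0; have := wordmx_ge0 u 1 0; lra.
by have := wordmx_row_ge1 su; have := wordmx_col_ge0 u0; lra.
Qed.

Definition height u := wordmx u 0 0.

Lemma height_cat_ge u v : height u * height v <= height (u ++ v).
Proof.
by rewrite /height wordmx_cat mulmx2E lerDl mulr_ge0 ?wordmx_ge0.
Qed.

Lemma height_cat_le u v : height (u ++ v) <= 2 * (height u * height v).
Proof.
rewrite /height wordmx_cat mulmx2E mulr_natl mulr2n lerD2l.
by rewrite ler_pM ?wordmx_ge0 ?wordmx_le00.
Qed.

Lemma height_ge_exp u : s ^+ size u <= height u.
Proof.
elim: u => [|b u IH]; first by rewrite /height /= mxE.
rewrite exprS; apply: le_trans (height_cat_ge [:: b] u).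
apply: ler_pM => //; rewrite ?exprn_ge0 ?sqrtr_ge0 //.
rewrite /height wordmx_cons0 /= !mxE /= mulr1 addr0.
by rewrite ler_peMr ?sqrtr_ge0 // lerDl.
Qed.

Lemma height_ge1 u : 1 <= height u.
Proof.
apply: le_trans (height_ge_exp u); apply: exprn_ege1.
by have /andP[/ltW] := sqrt2_bounds.
Qed.

Lemma height_gt0 u : 0 < height u.
Proof. exact: lt_le_trans ltr01 (height_ge1 u). Qed.

Lemma height1 b : height [:: b] <= 3.
Proof.
rewrite /height wordmx_cons0 /= !mxE /= mulr1 addr0.
by case/andP: (coef_bounds b).
Qed.

(** Ensures that the first prefix reaching a threshold overshoots it by a bounded factor only. *)
Lemma height_rcons u b : height (rcons u b) <= 6 * height u.
Proof.
rewrite -cats1; apply: le_trans (height_cat_le _ _) _.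
by have := height1 b; have := height_gt0 u; nra.
Qed.

(* Up to conjugation by diag(1, s), an even (resp. odd) word is an integer matrix
   (resp. s^-1 times one): its entries are alternately in Z and in s Z. *)
Definition twisted (e : bool) (r : R) := exists m : int, r = m%:~R * s ^+ e.

Lemma twistedD e r r' : twisted e r -> twisted e r' -> twisted e (r + r').
Proof. by move=> [m ->] [m' ->]; exists (m + m'); rewrite intrD mulrDl. Qed.

Lemma twistedM e e' r r' :
  twisted e r -> twisted e' r' -> twisted (e (+) e') (r * r').
Proof.
move=> [m ->] [m' ->]; case: e e' => [] [] /=.
- by exists (m * m' * 2); rewrite !intrM ?expr1 mulrACA sqr_sqrt2 mulr1.
- by exists (m * m'); rewrite !intrM; ring.
- by exists (m * m'); rewrite !intrM; ring.
by exists (m * m'); rewrite !intrM; ring.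
Qed.

Lemma twisted_int (m : int) : twisted false m%:~R.
Proof. by exists m; rewrite mulr1. Qed.

Lemma twisted_sqrt2 : twisted true s.
Proof. by exists 1; rewrite mul1r expr1. Qed.

(** Replaces the gap around 0 in Z for numbers that may lie in [s] Z. *)
Lemma twisted_ge1 e r : twisted e r -> r != 0 -> 1 <= `|r|.
Proof.
move=> [m ->]; rewrite mulf_eq0 negb_or intr_eq0 => /andP[m0 _].
rewrite normrM -intr_norm ger0_norm ?exprn_ge0 ?sqrtr_ge0 //.
have ? : 1 <= (`|m|%:~R : R) by rewrite ler1z; lia.
have /andP[s1 _] := sqrt2_bounds.
by rewrite -[leLHS]mulr1; apply: ler_pM => //; apply: exprn_ege1; apply: ltW.
Qed.

Lemma wordmx_twisted u (i j : 'I_2) :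
  twisted (odd (size u) (+) odd (i + j)) (wordmx u i j).
Proof.
elim: u i j => [|b u IH] i j.
  by case: (ord2P i) (ord2P j) => -> [] -> /=; rewrite mxE /=;
     [exists 1|exists 0|exists 0|exists 1]; rewrite ?mul0r ?mul1r.
have t0 := IH 0 j; have t1 := IH 1 j.
case: (ord2P i) => -> /=; last first.
  rewrite wordmx_cons1; rewrite /= in t0; move: t0.
  by case: (odd _); case: (odd _).
rewrite wordmx_cons0; apply: twistedD; last first.
  by rewrite /= in t1; move: t1; case: (odd _); case: (odd _).
(* The coefficient of the new letter lies in [s] Z, which accounts for the flipped parity of the
   length. *)
have -> : ~~ odd (size u) (+) odd (0%R + j) =
          (true (+) false) (+) (odd (size u) (+) odd ((0%R : 'I_2) + j)).
  by rewrite /=; case: (odd _); case: (odd _).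
apply: twistedM => //; apply: twistedM; first exact: twisted_sqrt2.
by have := twisted_int (1 + b : nat)%:Z; rewrite -pmulrn natrD.
Qed.
End Words.

(** * The limit of a sequence of words *)

Section Brackets.
Variable R : realType.
Implicit Types (t : R) (u v : seq bool).

Local Notation s := (Num.sqrt 2 : R).
Local Notation wordmx := (wordmx R).

Definition rho t (M : 'M[R]_2) (j : 'I_2) := M 0 j - t * M 1 j.

(* t lies between the quotients of the two columns of M. *)
Definition brackets t (M : 'M[R]_2) := rho t M 0 * rho t M 1 <= 0.

(** The columns of a product [U *m V] are nonnegative combinations of those of [U], so the quotients
    of a longer word lie between those of its prefix. *)
Lemma brackets_prefix t u v :
  brackets t (wordmx (u ++ v)) -> brackets t (wordmx u).
Proof.
rewrite /brackets wordmx_cat; set U := wordmx u; set V := wordmx v.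
have E j : rho t (U *m V) j = rho t U 0 * V 0 j + rho t U 1 * V 1 j.
  by rewrite /rho !mulmx2E; ring.
rewrite !E; move: (rho t U 0) (rho t U 1) => a b.
have v00 : 0 <= V 0 0 := wordmx_ge0 _ _ _ _.
have v01 : 0 <= V 0 1 := wordmx_ge0 _ _ _ _.
have v10 : 0 <= V 1 0 := wordmx_ge0 _ _ _ _.
have v11 : 0 <= V 1 1 := wordmx_ge0 _ _ _ _.
have d1 : `|\det V| = 1 := normr_det_wordmx _ _.
(* This permanent is the coefficient of [a * b] in the product of the two forms. Being at least 1,
   it makes that product positive as soon as [a * b] is. *)
have d2 : 1 <= V 0 0 * V 1 1 + V 0 1 * V 1 0.
  rewrite -d1 det_mx2; apply: le_trans (ler_normB _ _) _.
  by rewrite !ger0_norm ?mulr_ge0.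
move: d2 v00 v01 v10 v11 {d1 E}; move: (V 0 0) (V 0 1) (V 1 0) (V 1 1).
move=> p q r w d2 p0 q0 r0 w0 h.
rewrite leNgt; apply/negP => ab0.
have h1 : 0 <= a ^+ 2 * (p * q) by rewrite mulr_ge0 ?sqr_ge0 ?mulr_ge0.
have h2 : 0 <= b ^+ 2 * (r * w) by rewrite mulr_ge0 ?sqr_ge0 ?mulr_ge0.
have h3 : a * b <= a * b * (p * w + q * r) by rewrite ler_peMr // ltW.
by move: h; apply/negP; rewrite -ltNge; lra.
Qed.

(** The determinant, of absolute value 1, is [rho t U 0 * U 1 1 - rho t U 1 * U 1 0]. As the two
    forms have opposite signs, nothing cancels and each term is at most 1 in absolute value; the
    entries of the second row have the order of the height. *)
Lemma rho_bound t u j : (1 < size u)%N -> brackets t (wordmx u) ->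
  `|rho t (wordmx u) j| <= 16 / height R u.
Proof.
move=> su; rewrite /brackets; set U := wordmx u => ab.
have d1 : `|\det U| = 1 := normr_det_wordmx _ _.
have E : \det U = rho t U 0 * U 1 1 - rho t U 1 * U 1 0.
  by rewrite det_mx2 /rho; ring.
have u0 : 0 <= U 1 0 := wordmx_ge0 _ _ _ _.
have u1 : 0 <= U 1 1 := wordmx_ge0 _ _ _ _.
have sq : (rho t U 0 * U 1 1 - rho t U 1 * U 1 0) ^+ 2 = 1.
  by rewrite -E -real_normK ?num_real // d1 expr1n.
have cross : rho t U 0 * rho t U 1 * (U 1 0 * U 1 1) <= 0.
  by rewrite mulr_le0_ge0 // mulr_ge0.
have {ab} [i] : exists i, `|rho t U j * U 1 i| <= 1.
  move: sq cross; case: (ord2P j) => -> sq cross; [exists 1|exists 0];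
    rewrite -(@ler_pXn2r _ 2) ?nnegrE // expr1n real_normK ?num_real //.
    have := sqr_ge0 (rho t U 1 * U 1 0); move: sq cross.
    by move: (rho t U 0) (rho t U 1) => a b; nra.
  have := sqr_ge0 (rho t U 0 * U 1 1); move: sq cross.
  by move: (rho t U 0) (rho t U 1) => a b; nra.
rewrite normrM (ger0_norm (wordmx_ge0 _ _ _ _)) => h.
rewrite ler_pdivlMr ?height_gt0 //.
have := wordmx_ge00 R i su; rewrite -/(height R u) => h1.
apply: le_trans (ler_wpM2l (normr_ge0 _) h1) _.
by rewrite mulrCA -[leRHS]mulr1 ler_pM2l.
Qed.

(** Nested intervals: the quotients of the columns of [w n] are the ends of the n-th one, and the
    supremum of the lower ends lies in all of them. *)
Lemma exists_brackets (w : nat -> seq bool) :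
  (forall n, (1 < size (w n))%N) ->
  (forall n, exists v, w n.+1 = w n ++ v) ->
  exists t, forall n, brackets t (wordmx (w n)).
Proof.
move=> sw ww.
have wE m n : (m <= n)%N -> exists v, w n = w m ++ v.
  elim: n => [|n IH]; first by rewrite leqn0 => /eqP ->; exists [::]; rewrite cats0.
  rewrite leq_eqVlt => /orP[/eqP ->|]; first by exists [::]; rewrite cats0.
  rewrite ltnS => /IH [v Ev]; have [v' Ev'] := ww n.
  by exists (v ++ v'); rewrite Ev' Ev catA.
pose e n j := wordmx (w n) 0 j / wordmx (w n) 1 j.
have pos n j : 0 < wordmx (w n) 1 j.
  have := wordmx_ge00 R j (sw n); have := height_gt0 R (w n).
  by rewrite /height; lra.
have rhoE t n j : rho t (wordmx (w n)) j = (e n j - t) * wordmx (w n) 1 j.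
  by rewrite /rho /e mulrBl divfK // gt_eqF.
have brE t n : brackets t (wordmx (w n)) = ((e n 0 - t) * (e n 1 - t) <= 0).
  by rewrite /brackets !rhoE mulrACA pmulr_lle0 // mulr_gt0.
(* A word brackets its own column quotient [e n 0], hence so do its prefixes. Any two of the
   intervals thus have a common point. *)
have nested m n : (m <= n)%N -> (e m 0 - e n 0) * (e m 1 - e n 0) <= 0.
  move=> /wE [v Ev]; rewrite -brE; apply: (@brackets_prefix _ _ v).
  by rewrite -Ev brE subrr mul0r.
pose lo n := Num.min (e n 0) (e n 1); pose hi n := Num.max (e n 0) (e n 1).
have betw n t : ((e n 0 - t) * (e n 1 - t) <= 0) = (lo n <= t <= hi n).
  rewrite /lo /hi ge_min le_max.
  move: (e n 0) (e n 1) => a b.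
  apply/idP/idP.
    move=> h; apply/andP; split; apply/orP.
      have [?|?] := leP a t; first by left.
      by right; nra.
    have [?|?] := leP t a; first by left.
    by right; nra.
  case/andP => /orP[] h1 /orP[] h2.
  - by have -> : a = t; [lra|rewrite subrr mul0r].
  - by rewrite mulr_le0_ge0 ?subr_le0 ?subr_ge0.
  - by rewrite mulr_ge0_le0 ?subr_le0 ?subr_ge0.
  - by have -> : b = t; [lra|rewrite subrr mulr0].
have lohi m n : lo m <= hi n.
  case: (leqP m n) => [/nested|/ltnW/nested]; rewrite betw => /andP[h1 h2].
    by apply: le_trans h1 _; rewrite /hi le_max lexx.
  by apply: le_trans h2; rewrite /lo ge_min lexx.
pose S := [set lo n | n in setT]%classic.
exists (sup S) => n; rewrite brE betw; apply/andP; split.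
  apply: ub_le_sup; last by exists n.
  by exists (hi 0) => _ [m _ <-].
by apply: ge_sup; [exists (lo 0), 0|move=> _ [m _ <-]].
Qed.

(* For each rational p / q, the first prefix u of height at least 32 |q| has
   height of order |q|, and a column of its matrix not proportional to (s p, q). *)
Lemma brackets_badly_approximable t (w : nat -> seq bool) :
  (forall n, brackets t (wordmx (w n))) ->
  (forall B : R, exists n, B <= height R (w n)) ->
  badly_approximable (t / s).
Proof.
(* The estimates below give 1/2 <= 288 q^2 |xi - p/q|, and 576 < 1000. *)
move=> tw hw; exists (1 / 1000) => [|p q q0]; first by lra.
have q1 : 1 <= `|q%:~R : R|.
  by rewrite -intr_norm ler1z; lia.
set Q := `|q%:~R : R| in q1.
have [n hn] := hw (32 * Q).
have ex : exists k, 32 * Q <= height R (take k (w n)).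
  by exists (size (w n)); rewrite take_size.
case: (ex_minnP ex) => k hk kmin.
set u := take k (w n) in hk.
have bu : brackets t (wordmx u).
  by apply: (@brackets_prefix _ _ (drop k (w n))); rewrite cat_take_drop.
have su : (1 < size u)%N.
  move: hk; case: {bu kmin} u => [|b [|//]] /=.
    by rewrite /height /= mxE /= => h; exfalso; lra.
  by move=> h; exfalso; have := height1 R b; lra.
(* By minimality, deleting the last letter brings the height below 32 [Q], and a letter costs a
   factor 6. *)
have hu : height R u <= 192 * Q.
  have k0 : (0 < k)%N by move: su; rewrite /u; case: (k) => //; rewrite take0.
  have kw : (k.-1 < size (w n))%N.
    rewrite ltnNge; apply/negP => h.
    have /kmin : 32 * Q <= height R (take k.-1 (w n)) by rewrite take_oversize.
    by rewrite -[k in (k <= _)%N](prednK k0) ltnn.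
  have -> : u = rcons (take k.-1 (w n)) (nth false (w n) k.-1).
    by rewrite -take_nth // prednK.
  apply: le_trans (height_rcons _ _ _) _.
  suff : height R (take k.-1 (w n)) <= 32 * Q by lra.
  rewrite leNgt; apply/negP => /ltW /kmin.
  by rewrite -[k in (k <= _)%N](prednK k0) ltnn.
set U := wordmx u in bu.
have d1 : `|\det U| = 1 := normr_det_wordmx _ _.
(* The determinant of column [j] of [U] and the vector (s p, q). If it vanished for both columns,
   [U] would be singular. *)
pose D j := U 0 j * q%:~R - U 1 j * (s * p%:~R).
have [j Dj] : exists j, D j != 0.
  apply: contrapT => /forallNP D0.
  have {}D0 j : D j = 0 by apply/eqP/negPn/negP/D0.
  have : \det U * q%:~R = 0.
    transitivity (D 0 * U 1 1 - D 1 * U 1 0); last by rewrite !D0 !mul0r subrr.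
    by rewrite det_mx2 /D; ring.
  move/eqP; rewrite mulf_eq0 intr_eq0 (negPf q0) orbF => /eqP d0.
  by move: d1; rewrite d0 normr0 => /eqP; rewrite eq_sym oner_eq0.
have D1 : 1 <= `|D j|.
  apply: (@twisted_ge1 _ (odd (size u) (+) odd j)) => //.
  rewrite /D; apply: twistedD.
    have := twistedM (wordmx_twisted R u 0 j) (twisted_int R q).
    by rewrite addbF add0n.
  have := twistedM (wordmx_twisted R u 1 j)
            (twistedM (twisted_sqrt2 R) (twisted_int R (- p))).
  by rewrite /= intrN !mulrN add0n; case: (odd _); case: (odd _).
set xi := t / s; set z := xi - p%:~R / q%:~R.
have qR : (q%:~R : R) != 0 by rewrite intr_eq0.
have DE : D j = rho t U j * q%:~R + s * U 1 j * (q%:~R * z).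
  have -> : q%:~R * z = q%:~R * xi - p%:~R.
    by rewrite /z mulrBr [X in _ - X]mulrC divfK.
  have -> : t = s * xi by rewrite /xi [s * _]mulrC divfK ?sqrt2_neq0.
  by rewrite /D /rho; ring.
have hu0 := height_gt0 R u.
(* The threshold 32 is twice the 16 of [rho_bound]: this term takes at most half of [D j], so the
   term containing [z] is at least 1/2. *)
have r1 : `|rho t U j| * Q <= 1 / 2.
  have := rho_bound j su bu; rewrite ler_pdivlMr // => h.
  have : `|rho t U j| * (32 * Q) <= 16.
    by apply: le_trans h; rewrite ler_wpM2l.
  lra.
have r2 : 1 / 2 <= s * U 1 j * (Q * `|z|).
  have : `|D j| <= `|rho t U j| * Q + s * U 1 j * (Q * `|z|).
    rewrite DE; apply: le_trans (ler_normD _ _) _.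
    rewrite !normrM (ger0_norm (sqrtr_ge0 _)).
    by rewrite (ger0_norm (wordmx_ge0 _ _ _ _)).
  lra.
have r3 : s * U 1 j * (Q * `|z|) <= 3 / 2 * (192 * Q) * (Q * `|z|).
  apply: ler_wpM2r; first by rewrite mulr_ge0 // normr_ge0.
  have /andP[_ s2] := sqrt2_bounds R.
  apply: ler_pM; rewrite ?sqrtr_ge0 ?wordmx_ge0 //; first exact: ltW.
  exact: le_trans (wordmx_le00 _ _ _ _) hu.
have -> : (q%:~R : R) ^+ 2 = Q ^+ 2 by rewrite /Q real_normK ?num_real.
rewrite ltr_pdivrMr ?exprn_gt0 //; last by lra.
rewrite expr2 mulrA.
by lra.
Qed.

End Brackets.

(** * Palindromic prefixes of the Fibonacci word *)

(** The two letters missing from [pal n]: the word [pal n ++ sep n] is standard, and its ending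
    alternates with the parity of n. *)
Definition sep (n : nat) : seq bool :=
  if odd n then [:: true; false] else [:: false; true].

(* The palindromic prefixes of the Fibonacci word: each is a word of the
   standard Fibonacci sequence without its last two letters. *)
Fixpoint pal (n : nat) : seq bool :=
  if n is n1.+1 then
    if n1 is n2.+1 then pal n1 ++ sep n1 ++ pal n2 else [:: false]
  else [::].

Lemma palSS n : pal n.+2 = pal n.+1 ++ sep n.+1 ++ pal n.
Proof. by []. Qed.

Lemma sepSS n : sep n.+2 = sep n.
Proof. by rewrite /sep /= negbK. Qed.

Lemma rev_sep n : rev (sep n.+1) = sep n.
Proof. by rewrite /sep /=; case: (odd n). Qed.

(** Consecutive standard words commute up to their last two letters. This is also the mirror image
    of the recursion, which makes the words palindromes. *)
Lemma palSS_rev n : pal n.+2 = pal n ++ sep n ++ pal n.+1.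
Proof.
elim: n => [//|n IH].
by rewrite palSS {2}IH palSS sepSS -!catA.
Qed.

Lemma rev_pal n : rev (pal n) = pal n.
Proof.
suff : rev (pal n) = pal n /\ rev (pal n.+1) = pal n.+1 by case.
elim: n => [//|n [IH1 IH2]]; split=> //.
by rewrite palSS !rev_cat rev_sep IH1 IH2 -catA -palSS_rev.
Qed.

Lemma odd_size_pal n : odd (size (pal n.+3)) = odd (size (pal n)).
Proof.
have E m : odd (size (pal m.+2)) = odd (size (pal m.+1)) (+) odd (size (pal m)).
  by rewrite palSS !size_cat !oddD /sep; case: (odd m.+1).
by rewrite !E; case: (odd _); case: (odd _).
Qed.

(** Provides infinitely many neighbouring palindromes of opposite parity, whose points will have
    determinants 1 and 2 in absolute value. *)
Lemma odd_size_pal2 k :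
  odd (size (pal (k * 3).+2)) /\ ~~ odd (size (pal (k * 3).+3)).
Proof.
elim: k => [//|k].
by rewrite mulSn !add3n !(odd_size_pal _.+2, odd_size_pal _.+3).
Qed.

Lemma size_pal n : (2 < size (pal n.+2))%N.
Proof.
elim: n => [//|n IH]; rewrite palSS size_cat.
exact: leq_trans IH (leq_addr _ _).
Qed.

(** * Integer points attached to palindromes *)

Section Points.
Variable R : realType.
Implicit Types (xi C : R) (x : nat -> 'M[int]_2) (Q : nat -> R).

Local Notation s := (Num.sqrt 2 : R).

Lemma intr_norm_lt1 (m : int) : `|m%:~R : R| < 1 -> m = 0.
Proof. by rewrite -intr_norm -[1]/(1%:~R) ltr_int; lia. Qed.

Definition linform xi (a : 'M[int]_2) (j : 'I_2) : R :=
  xi * (a 0 j)%:~R - (a 1 j)%:~R.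

Lemma approx_rowE xi (a : 'M[int]_2) j :
  (approx_row xi *m map_mx intr a) 0 j = linform xi a j.
Proof. by rewrite mulmx2E !mxE /= mulN1r. Qed.

(** A common interface for the palindromic points of the constructed number and for the points W_i
    N_i of an associated sequence. Extremality is derived from it for the former, uniqueness of good
    approximations for the latter. *)
Record fibonacci_points xi x Q C : Prop := FibonacciPoints {
  fp_gt0 : 0 < C;
  fp_sym : forall i, x i 1 0 = x i 0 1;
  fp_size_gt0 : forall i, 0 < Q i;
  fp_le : forall i, `|(x i 0 0)%:~R| <= C * Q i;
  fp_approx : forall i j, `|linform xi (x i) j| <= C / Q i;
  fp_mul_le : forall i, Q i.+2 <= C * (Q i.+1 * Q i);
  fp_mul_ge : forall i, Q i.+1 * Q i <= C * Q i.+2;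
  fp_unbounded : forall B, exists n, forall i, (n <= i)%N -> B <= Q i;
  fp_det3 : forall i, det3 (x i) (x i.+1) (x i.+2) != 0 }.

(** Column operations replace the last two coordinates by the approximation errors, so that each
    term is one size times two errors. *)
Lemma linform_det3 xi (a b c : 'M[int]_2) :
  a 1 0 = a 0 1 -> b 1 0 = b 0 1 -> c 1 0 = c 0 1 ->
  (det3 a b c)%:~R =
    (a 0 0)%:~R * (linform xi b 0 * linform xi c 1 - linform xi b 1 * linform xi c 0)
  - (b 0 0)%:~R * (linform xi a 0 * linform xi c 1 - linform xi a 1 * linform xi c 0)
  + (c 0 0)%:~R * (linform xi a 0 * linform xi b 1 - linform xi a 1 * linform xi b 0).
Proof.
move=> ha hb hc; rewrite /linform /det3 ha hb hc !(rmorphD, rmorphN, rmorphM) /=.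
by ring.
Qed.

Definition scale (u : seq bool) : R := if odd (size u) then s^-1 else 1.

Lemma scale_neq0 u : scale u != 0.
Proof. by rewrite /scale; case: ifP; rewrite ?invr_eq0 ?sqrt2_neq0 ?oner_neq0. Qed.

(** For a palindrome the matrix is symmetric, and its entries, read from the last to the first, are
    nearly proportional to 1, t, t^2. The weights 2, [s], 1 turn this into 1, xi, xi^2 for xi = t /
    s, and [scale] makes the entries integers. *)
Lemma palindrome_point u : rev u = u -> exists a : 'M[int]_2,
  [/\ a 1 0 = a 0 1, (a 0 0)%:~R = scale u * (2 * wordmx R u 1 1),
      (a 0 1)%:~R = scale u * (s * wordmx R u 0 1) &
      (a 1 1)%:~R = scale u * wordmx R u 0 0].
Proof.
move=> ru.
have := wordmx_twisted R u 0 0; have := wordmx_twisted R u 0 1.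
have := wordmx_twisted R u 1 1; rewrite /scale /=.
case: (odd (size u)) => /= -[m11 ->] [m01 ->] [m00 ->].
  exists (\matrix_(i, j) if i != j then m01 else if i == 0 then 2 * m11 else m00).
  rewrite !mxE /= expr1 expr0 mulr1 intrM.
  have s0 := sqrt2_neq0 R.
  by split => //; field.
exists (\matrix_(i, j) if i != j then 2 * m01 else if i == 0 then 2 * m11 else m00).
rewrite !mxE /= expr1 expr0 !mulr1 !intrM !mul1r.
by split => //; rewrite mulrCA sqr_sqrt2 mulrC.
Qed.

(** Both letters being symmetric, symmetry of their product would mean that they commute. *)
Lemma sep_not_symmetric n : wordmx R (sep n) 1 0 - wordmx R (sep n) 0 1 != 0.
Proof.
rewrite /sep; case: (odd n).
  rewrite !(wordmx_cons1, wordmx_cons0) /= !mxE /=.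
  by have := sqrt2_gt0 R; move=> h; rewrite lt_eqF //; lra.
rewrite !(wordmx_cons1, wordmx_cons0) /= !mxE /=.
by have := sqrt2_gt0 R; move=> h; rewrite gt_eqF //; lra.
Qed.

Lemma wordmx_pal_sym n : wordmx R (pal n) 1 0 = wordmx R (pal n) 0 1.
Proof. by rewrite wordmx_trE rev_pal. Qed.

Lemma det3_pal n :
  det3 (wordmx R (pal n)) (wordmx R (pal n.+1)) (wordmx R (pal n.+2)) != 0.
Proof.
have E : wordmx R (pal n.+2) =
    wordmx R (pal n.+1) *m wordmx R (sep n.+1) *m wordmx R (pal n).
  by rewrite palSS !wordmx_cat mulmxA.
have d m : \det (wordmx R (pal m)) != 0.
  by rewrite -normr_gt0 normr_det_wordmx.
have := wordmx_pal_sym n.+2; rewrite E => h.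
rewrite (det3_mul (wordmx_pal_sym n) (wordmx_pal_sym n.+1) h).
by rewrite !mulf_neq0 // sep_not_symmetric.
Qed.

Lemma norm_scale_le1 u : `|scale u| <= 1.
Proof.
rewrite /scale; case: ifP => _; last by rewrite normr1.
have /andP[s1 _] := sqrt2_bounds R.
by rewrite ger0_norm ?invr_ge0 ?sqrtr_ge0 // invf_le1 ?sqrt2_gt0 // ltW.
Qed.

Lemma height_pal_double n : 2 * height R (pal n.+2) <= height R (pal n.+3).
Proof.
rewrite (palSS n.+1) mulrC.
apply: le_trans (height_cat_ge R _ _); rewrite ler_pM2l ?height_gt0 //.
apply: le_trans (height_cat_ge R _ _).
have h1 := height_ge1 R (pal n.+1).
have h2 : 2 <= height R (sep n.+2).
  apply: le_trans (height_ge_exp R _).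
  have -> : size (sep n.+2) = 2%N by rewrite /sep; case: odd.
  by rewrite expr2 sqr_sqrt2.
by nra.
Qed.

Lemma height_pal_ge n : n%:R <= height R (pal n.+2).
Proof.
elim: n => [|n IH]; first by rewrite ltW ?height_gt0.
apply: le_trans (height_pal_double n).
by have := height_ge1 R (pal n.+2); rewrite -natr1; lra.
Qed.

Lemma height_sep n : height R (sep n) <= 18.
Proof.
have h b c : height R [:: b; c] <= 18.
  apply: le_trans (height_cat_le R [:: b] [:: c]) _.
  have := height1 R b; have := height1 R c.
  by have := height_gt0 R [:: b]; have := height_gt0 R [:: c]; nra.
by rewrite /sep; case: odd; exact: h.
Qed.

Lemma exists_fibonacci_points : exists xi x Q C,
  [/\ badly_approximable xi, fibonacci_points xi x Q C &
      forall n, exists2 i, (n <= i)%N &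
        (absz (\det (x i)) * absz (\det (x i.+1)))%N = 2%N].
Proof.
(* The shift makes every word long enough for [rho_bound]. *)
pose w n := pal n.+2.
have [t tw] : exists t, forall n, brackets t (wordmx R (w n)).
  apply: exists_brackets => n; first exact: ltnW (size_pal n).
  by exists (sep n.+2 ++ pal n.+1); rewrite /w palSS.
have hw B : exists n, forall i, (n <= i)%N -> B <= height R (w i).
  exists (Num.bound `|B|) => i Bi; apply: le_trans (height_pal_ge i).
  apply: ltW; apply: le_lt_trans (ler_norm _) _.
  by apply: lt_le_trans (archi_boundP (normr_ge0 _)) _; rewrite ler_nat.
have [x xP] := boolp.choice (fun n => palindrome_point (rev_pal n.+2)).
(* The largest constant required is that of [fp_mul_le]: two concatenations and a separator of
   height at most 18 give 2 * 2 * 18. *)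
exists (t / s), x, (fun n => height R (w n)), 72.
have s0 := sqrt2_neq0 R.
split.
- apply: brackets_badly_approximable tw _ => B.
  by have [n /(_ n (leqnn n))] := hw B; exists n.
- split => //.
  + by move=> i; have [] := xP i.
  + by move=> i; apply: height_gt0.
  + move=> i; have [_ -> _ _] := xP i; rewrite normrM.
    have := norm_scale_le1 (pal i.+2); have := height_gt0 R (w i).
    have := wordmx_le00 R (pal i.+2) 1 1; have := wordmx_ge0 R (pal i.+2) 1 1.
    rewrite -/(height R _) normrM => p0 p1 h0 l1; rewrite (ger0_norm p0).
    apply: le_trans (ler_wpM2r _ l1) _; first by rewrite mulr_ge0.
    by rewrite mul1r ger0_norm // /w; lra.
  + move=> i j; have [x10 x00 x01 x11] := xP i.
    set u := pal i.+2 in x00 x01 x11 *.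
    have h0 : 0 < height R u := height_gt0 R _.
    have sym : wordmx R u 1 0 = wordmx R u 0 1 := wordmx_pal_sym _.
    have tE : t = t / s * s by rewrite divfK.
    have [k [a [a2 E]]] : exists k (a : R), `|a| <= 2 /\
        linform (t / s) (x i) j = scale u * (a * rho t (wordmx R u) k).
      case: (ord2P j) => ->; rewrite /linform /rho.
        exists 1, (- s); split.
          have /andP[_ s2] := sqrt2_bounds R.
          by rewrite normrN ger0_norm ?sqrtr_ge0 //; lra.
        rewrite x10 x00 x01 {2}tE.
        transitivity (scale u * (t / s * (s * s) * wordmx R u 1 1 -
                                 s * wordmx R u 0 1)); last by ring.
        by rewrite sqr_sqrt2; ring.
      exists 0, (- 1); split; first by rewrite normrN normr1; lra.
      by rewrite x01 x11 sym; field.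
    rewrite E !normrM ler_pdivlMr //.
    have := rho_bound k (ltnW (size_pal i)) (tw i); rewrite ler_pdivlMr //.
    move=> rh; apply: le_trans (_ : 1 * 2 * 16 <= _); last by lra.
    rewrite !mulrA -[leLHS]mulrA; apply: ler_pM => //; rewrite ?mulr_ge0 //;
      first exact: ltW.
    by apply: ler_pM => //; exact: norm_scale_le1.
  + move=> i; rewrite /w (palSS i.+2).
    apply: le_trans (height_cat_le R _ _) _.
    have h1 := height_cat_le R (sep i.+3) (pal i.+2).
    have h2 := height_sep i.+3.
    have h3 := height_gt0 R (pal i.+2).
    have h4 : height R (sep i.+3 ++ pal i.+2) <= 36 * height R (pal i.+2) by nra.
    by have := ler_wpM2l (ltW (height_gt0 R (pal i.+3))) h4; lra.
  + move=> i; rewrite /w (palSS i.+2).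
    have h1 := height_cat_ge R (pal i.+3) (sep i.+3 ++ pal i.+2).
    have h2 := height_cat_ge R (sep i.+3) (pal i.+2).
    have h3 := height_ge1 R (sep i.+3).
    have h4 := height_gt0 R (pal i.+2).
    have h5 := height_gt0 R (pal i.+3).
    have h6 : height R (pal i.+2) <= height R (sep i.+3 ++ pal i.+2) by nra.
    have h7 := ler_wpM2l (ltW h5) h6.
    by have := height_gt0 R (pal i.+3 ++ sep i.+3 ++ pal i.+2); lra.
  + move=> i.
    have [_ a00 a01 a11] := xP i.
    have [_ b00 b01 b11] := xP i.+1.
    have [_ c00 c01 c11] := xP i.+2.
    rewrite -(intr_eq0 R).
    (* The sign comes from reversing the order of the coordinates, the factor [2 * s] from their
       weights. *)
    have -> : (det3 (x i) (x i.+1) (x i.+2))%:~R =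
      - (2 * s * (scale (w i) * (scale (w i.+1) * scale (w i.+2))) *
         det3 (wordmx R (w i)) (wordmx R (w i.+1)) (wordmx R (w i.+2))).
      rewrite /det3 !(rmorphD, rmorphN, rmorphM) /=.
      rewrite a00 a01 a11 b00 b01 b11 c00 c01 c11 /w.
      by ring.
    rewrite oppr_eq0 !mulf_neq0 ?scale_neq0 ?det3_pal //.
move=> n; exists (n * 3)%N; first by rewrite leq_pmulr.
have [h1 h2] := odd_size_pal2 n.
have detx m : `|\det (x m)|%:~R = 2 * (scale (pal m.+2) * scale (pal m.+2)).
  have [x10 x00 x01 x11] := xP m.
  rewrite intr_norm; have -> : (\det (x m))%:~R =
      2 * (scale (pal m.+2) * scale (pal m.+2)) * \det (wordmx R (pal m.+2)).
    rewrite !det_mx2 wordmx_pal_sym x10 rmorphB !rmorphM /= x00 x01 x11.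
    set l := scale _; transitivity (l * l * (2 * wordmx R (pal m.+2) 0 0 *
      wordmx R (pal m.+2) 1 1 - s * s * wordmx R (pal m.+2) 0 1 ^+ 2)); first by ring.
    by rewrite sqr_sqrt2; ring.
  rewrite normrM normr_det_wordmx mulr1 ger0_norm // mulr_ge0 //.
  by rewrite -expr2 sqr_ge0.
have det1 : absz (\det (x (n * 3)%N)) = 1%N.
  have := detx (n * 3)%N; rewrite /scale h1 -invfM sqr_sqrt2 divff //.
  by move/eqP; rewrite -[X in _ == X]/(1%:~R) eqr_int => /eqP; lia.
have det2 : absz (\det (x (n * 3).+1)) = 2%N.
  have := detx (n * 3).+1; rewrite /scale (negPf h2) !mulr1.
  by move/eqP; rewrite -[X in _ == X]/(2%:~R) eqr_int => /eqP; lia.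
by rewrite det1 det2.
Qed.
End Points.

(** * Extremality *)

Section Extremal.
Variable R : realType.
Implicit Types (xi C : R) (x : nat -> 'M[int]_2) (Q : nat -> R).

Local Notation g := (golden R).

Lemma golden_eq : g * g = g + 1.
Proof.
rewrite /golden; have : Num.sqrt 5 * Num.sqrt 5 = 5 :> R.
  by rewrite -expr2 sqr_sqrtr.
by move: (Num.sqrt 5) => t tt; field: tt.
Qed.

Lemma golden_bounds : 1 < g < 2.
Proof.
have : 0 < g by rewrite /golden divr_gt0 // addr_gt0 // sqrtr_gt0.
have := golden_eq; move: g => t tt t0.
by apply/andP; split; nra.
Qed.

Lemma golden_gt0 : 0 < g.
Proof. by have /andP[] := golden_bounds; lra. Qed.

(* The deviations e_i = ln Q_(i+1) - g ln Q_i satisfy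
   e_(i+1) = (1 - g) e_i + O(1), with |1 - g| < 1. *)
Lemma growth_golden Q C : 0 < C -> (forall i, 0 < Q i) ->
  (forall i, Q i.+2 <= C * (Q i.+1 * Q i)) ->
  (forall i, Q i.+1 * Q i <= C * Q i.+2) ->
  exists M, forall i, ln (Q i.+1) <= M + g * ln (Q i).
Proof.
move=> C0 Q0 Qle Qge.
pose q i := ln (Q i); pose e i := q i.+1 - g * q i.
have /andP[g1 g2] := golden_bounds; have gg := golden_eq.
have h1 i : q i.+2 <= ln C + q i.+1 + q i.
  rewrite /q -addrA -!lnM ?posrE ?mulr_gt0 //.
  by rewrite ler_ln ?posrE ?mulr_gt0.
have h2 i : q i.+1 + q i <= ln C + q i.+2.
  by rewrite /q -!lnM ?posrE ?mulr_gt0 // ler_ln ?posrE ?mulr_gt0.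
have E i : e i.+1 = - (g - 1) * e i + (q i.+2 - q i.+1 - q i).
  rewrite /e; transitivity (q i.+2 - g * q i.+1 + (g * g - g - 1) * q i); last by ring.
  by rewrite gg; ring.
have c0 : 0 <= ln C by have := h1 0; have := h2 0; lra.
(* Chosen so that (g - 1) [M] + ln [C] <= [M]: the interval [-M, M] contains [e 0] and is stable
   under the recursion. *)
pose M := `|e 0| + ln C / (2 - g).
have Mc : M * (2 - g) >= ln C.
  rewrite /M mulrDl divfK ?lerDr ?mulr_ge0 ?normr_ge0 //; first by lra.
  by rewrite gt_eqF; lra.
suff eM i : - M <= e i <= M.
  by exists M => i; have := eM i; rewrite /e /q => /andP[_]; lra.
have M0 : 0 <= M by rewrite /M addr_ge0 // divr_ge0 //; lra.
elim: i => [|i /andP[IH1 IH2]].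
  by rewrite -ler_norml /M lerDl divr_ge0 //; lra.
rewrite E; have := h1 i; have := h2 i.
move: (q i.+2) (q i.+1) (q i) (e i) IH1 IH2 Mc M0 => a b c d IH1 IH2 Mc M0 k1 k2.
by apply/andP; split; nra.
Qed.

Lemma not_rational_of_badly_approximable xi :
  badly_approximable xi -> ~ Defs.rational xi.
Proof.
move=> [c c0 h] [r xiE]; have := h (numq r) (denq r) (denq_neq0 r).
have -> : xi = (numq r)%:~R / (denq r)%:~R by [].
rewrite subrr normr0; apply/negP; rewrite -leNgt mulr_ge0 ?(ltW c0) //.
by rewrite invr_ge0 sqr_ge0.
Qed.

Lemma quadratic_int_relation xi : quadratic xi -> exists a : nat -> int,
  (a 2%N != 0) /\ (a 0%N)%:~R + (a 1%N)%:~R * xi + (a 2%N)%:~R * xi ^+ 2 = 0.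
Proof.
move=> [p [sp _ /rootP pxi]].
have [q [d d0 pE]] := rat_poly_scale p.
exists (fun i => q`_i); split.
  apply/eqP => q2; have : lead_coef p != 0 by rewrite lead_coef_eq0 -size_poly_eq0 sp.
  by rewrite lead_coefE sp pE coefZ coef_map /= q2 mulr0 eqxx.
have sq : (size (map_poly intr q : {poly R}) <= 3)%N.
  apply: leq_trans (size_poly _ _) _.
  have : size p = size (map_poly intr q : {poly rat}).
    by rewrite pE size_scale // invr_eq0 intr_eq0.
  rewrite sp size_map_inj_poly //; first by move=> ->.
  exact: intr_inj.
have : (map_poly intr q : {poly R}).[xi] = 0.
  move: pxi; rewrite pE linearZ /= -map_poly_comp /= hornerZ => /eqP.
  rewrite mulf_eq0 fmorph_eq0 invr_eq0 intr_eq0 (negPf d0) /= => /eqP <-.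
  by congr horner; apply: eq_map_poly => z /=; rewrite ratr_int.
rewrite (horner_coef_wide _ sq) !big_ord_recl big_ord0 /= !coef_map /= => <-.
by rewrite expr0 expr1 mulr1 addr0 addrA.
Qed.

(** On the points, the integer form [L] given by a quadratic relation is a combination of the
    approximation errors, hence eventually less than 1 and so zero. It cannot vanish at three
    independent points. *)
Lemma fibonacci_points_not_quadratic xi x Q C :
  fibonacci_points xi x Q C -> ~ quadratic xi.
Proof.
move=> fp /quadratic_int_relation [a [a2 axi]].
pose L (b : 'M[int]_2) := a 0%N * b 0 0 + a 1%N * b 0 1 + a 2%N * b 1 1.
pose A : R := `|(a 1%N)%:~R| + `|(a 2%N)%:~R| * (`|xi| + 1).
have A0 : 0 <= A by rewrite addr_ge0 // mulr_ge0 // addr_ge0.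
have C0 := fp_gt0 fp.
have [n hn] := fp_unbounded fp (A * C + 1).
have Ln i : (n <= i)%N -> L (x i) = 0.
  move=> /hn Qi; have Q0 := fp_size_gt0 fp i.
  apply: (@intr_norm_lt1 R).
  have -> : (L (x i))%:~R =
      - ((a 1%N)%:~R * linform xi (x i) 0
        + (a 2%N)%:~R * (xi * linform xi (x i) 0 + linform xi (x i) 1)).
    rewrite /L /linform !rmorphD !rmorphM /= (fp_sym fp).
    rewrite -[LHS]addr0 -[X in _ + X](mul0r (- (x i 0 0)%:~R)) -axi; ring.
  rewrite normrN; apply: le_lt_trans (_ : A * (C / Q i) < 1); last first.
    by rewrite mulrA ltr_pdivrMr //; lra.
  have l0 := fp_approx fp i 0; have l1 := fp_approx fp i 1.
  apply: le_trans (ler_normD _ _) _; rewrite !normrM /A mulrDl -mulrA.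
  apply: lerD; apply: ler_wpM2l => //.
  apply: le_trans (ler_normD _ _) _; rewrite normrM mulrDl mul1r.
  by apply: lerD => //; apply: ler_wpM2l.
have d := fp_det3 fp n.
have : a 2%N * det3 (x n) (x n.+1) (x n.+2) = 0.
  have L0 := Ln n (leqnn _); have L1 := Ln n.+1 (leqnSn _).
  have L2 : L (x n.+2) = 0 by apply: Ln; lia.
  transitivity (
      L (x n) * (x n.+1 0 0 * x n.+2 0 1 - x n.+1 0 1 * x n.+2 0 0)
    - L (x n.+1) * (x n 0 0 * x n.+2 0 1 - x n 0 1 * x n.+2 0 0)
    + L (x n.+2) * (x n 0 0 * x n.+1 0 1 - x n 0 1 * x n.+1 0 0)).
    by rewrite /L /det3; ring.
  by rewrite L0 L1 L2 !mul0r subr0 addr0.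
by move/eqP; rewrite mulf_eq0 (negPf a2) (negPf d).
Qed.

Lemma fibonacci_points_extremal xi x Q C :
  badly_approximable xi -> fibonacci_points xi x Q C -> extremal xi.
Proof.
move=> bxi fp; split.
- exact: not_rational_of_badly_approximable.
- exact: fibonacci_points_not_quadratic fp.
have C0 := fp_gt0 fp; have Q0 := fp_size_gt0 fp.
have [M hM] := growth_golden C0 Q0 (fp_mul_le fp) (fp_mul_ge fp).
have g0 := golden_gt0.
have gV0 : 0 < g^-1 by rewrite invr_gt0.
(* [c1] serves the small values of X, where the point (0, 0, 1) is used, and [c2] the others. *)
pose c1 := expR (g^-1 * ln (C * Q 0)).
pose c2 := (`|xi| + 1) * C * expR (g^-1 * (ln C + M)).
exists (c1 + c2).
  by rewrite ltr_wpDr ?expR_gt0 // !mulr_ge0 ?expR_ge0 ?addr_ge0 // ltW.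
move=> X X1; have X0 : 0 < X by lra.
have c1_ge0 : 0 <= c1 := expR_ge0 _.
have c2_ge0 : 0 <= c2 by rewrite !mulr_ge0 ?expR_ge0 ?addr_ge0 // ltW.
rewrite /powR (gt_eqF X0).
have ex : exists r, X < C * Q r.
  have [n /(_ n (leqnn n)) hn] := fp_unbounded fp (C^-1 * (X + 1)).
  exists n; rewrite -ltr_pdivrMl //; apply: lt_le_trans hn.
  by rewrite ltr_pM2l ?invr_gt0 //; lra.
(* For X between [C * Q i] and [C * Q i.+1] the point [x i] is taken; as [Q i.+1] is at most of
   order [Q i] to the power g, the error [C / Q i] is of order X^(-1/g). *)
case: (ex_minnP ex) => -[|i] hi imin.
  exists 0, 0, 1; split => //.
  - by rewrite normr0 ltW.
  - by rewrite mul0r subrr normr0 mulr_ge0 ?expR_ge0 // addr_ge0.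
  rewrite mul0r sub0r normrN normr1 mulrDl.
  apply: le_trans (_ : c1 * expR (- g^-1 * ln X) <= _); last first.
    by rewrite lerDl mulr_ge0 ?expR_ge0.
  rewrite /c1 -expRD -expR0 ler_expR mulNr -mulrBr mulr_ge0 //; first exact: ltW.
  by rewrite subr_ge0 ler_ln ?posrE ?mulr_gt0 // ltW.
have Xi : C * Q i <= X.
  by rewrite leNgt; apply/negP => /imin; rewrite ltnn.
have key : C / Q i * (`|xi| + 1) <= (c1 + c2) * expR (- g^-1 * ln X).
  rewrite mulrDl; apply: le_trans (_ : c2 * expR (- g^-1 * ln X) <= _); last first.
    by rewrite lerDr mulr_ge0 ?expR_ge0.
  rewrite /c2 mulrC mulrA -[leRHS]mulrA; apply: ler_wpM2l.
    by rewrite mulr_ge0 ?addr_ge0 // ltW.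
  rewrite -expRD -[(Q i)^-1]lnK ?posrE ?invr_gt0 // ler_expR lnV ?posrE //.
  rewrite mulNr -mulrBr lerNl -mulrN ler_pdivrMl //.
  have : ln X <= ln C + ln (Q i.+1).
    by rewrite -lnM ?posrE // ler_ln ?posrE ?mulr_gt0 // ltW.
  by have := hM i; lra.
exists (x i 0 0), (x i 0 1), (x i 1 1).
have s := fp_sym fp i.
have l0 := fp_approx fp i 0; have l1 := fp_approx fp i 1.
have E0 : (x i 0 0)%:~R * xi - (x i 0 1)%:~R = linform xi (x i) 0.
  by rewrite /linform s mulrC.
have E1 : (x i 0 0)%:~R * xi ^+ 2 - (x i 1 1)%:~R =
    xi * linform xi (x i) 0 + linform xi (x i) 1.
  by rewrite /linform s; ring.
have CQ : 0 <= C / Q i by rewrite divr_ge0 // ltW.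
rewrite E0 E1; split.
- move=> [x00 x01 x11]; have := fp_det3 fp i.
  by rewrite /det3 x00 x01 x11 !mul0r subr0 addr0 eqxx.
- exact: le_trans (fp_le fp i) Xi.
- apply: le_trans key; apply: le_trans l0 _.
  by rewrite ler_peMr // lerDr.
apply: le_trans key; apply: le_trans (ler_normD _ _) _.
rewrite normrM mulrDr mulr1 [_ * `|xi|]mulrC.
by apply: lerD => //; apply: ler_wpM2l.
Qed.
End Extremal.

(** * Uniqueness of the points *)

Section Proportional.
Variable R : realType.
Implicit Types (xi C : R) (x : nat -> 'M[int]_2) (Q : nat -> R).

Lemma normr_mul3_le (a b c A A' B' : R) :
  0 <= A' -> 0 <= B' -> `|a| <= A -> `|b| <= A' -> `|c| <= B' ->
  `|a * (b * c)| <= A * (A' * B').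
Proof.
by move=> ? ? ? ? ?; rewrite !normrM; apply: ler_pM => //; apply: ler_pM.
Qed.

(** The expansion of the determinant in the errors has six terms, each at most 1/8, so this integer
    is at most 3/4 in absolute value. *)
Lemma det3_eq0 xi (a b c : 'M[int]_2) (A X Y Z : R) :
  a 1 0 = a 0 1 -> b 1 0 = b 0 1 -> c 1 0 = c 0 1 ->
  0 < A -> 0 < X -> 0 < Y -> 0 < Z ->
  `|(a 0 0)%:~R| <= A * X -> `|(b 0 0)%:~R| <= A * Y -> `|(c 0 0)%:~R| <= A * Z ->
  (forall j, `|linform xi a j| <= A / X) ->
  (forall j, `|linform xi b j| <= A / Y) ->
  (forall j, `|linform xi c j| <= A / Z) ->
  8 * A ^+ 3 * X <= Y * Z -> 8 * A ^+ 3 * Y <= X * Z ->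
  8 * A ^+ 3 * Z <= X * Y ->
  det3 a b c = 0.
Proof.
move=> sa sb sc A0 X0 Y0 Z0 ha hb hc la lb lc hX hY hZ.
apply: (@intr_norm_lt1 R).
have term (u v w : 'M[int]_2) (U V W : R) : 0 < U -> 0 < V -> 0 < W ->
    `|(u 0 0)%:~R| <= A * U -> (forall j, `|linform xi v j| <= A / V) ->
    (forall j, `|linform xi w j| <= A / W) -> 8 * A ^+ 3 * U <= V * W ->
    `|(u 0 0)%:~R * (linform xi v 0 * linform xi w 1 -
       linform xi v 1 * linform xi w 0)| <= 1 / 4.
  move=> U0 V0 W0 hu hv hw h.
  have AV : 0 <= A / V by rewrite divr_ge0 // ltW.
  have AW : 0 <= A / W by rewrite divr_ge0 // ltW.
  have k i j : `|(u 0 0)%:~R * (linform xi v i * linform xi w j)| <= 1 / 8.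
    apply: le_trans (normr_mul3_le AV AW hu (hv i) (hw j)) _.
    rewrite [leLHS](_ : _ = A ^+ 3 * U / (V * W)); last first.
      by field; rewrite !gt_eqF.
    by rewrite ler_pdivrMr ?mulr_gt0 //; lra.
  rewrite mulrBr; apply: le_trans (ler_normB _ _) _.
  by have := k 0 1; have := k 1 0; lra.
rewrite (linform_det3 xi sa sb sc).
have t1 := term a b c X Y Z X0 Y0 Z0 ha lb lc hX.
have t2 := term b a c Y X Z Y0 X0 Z0 hb la lc hY.
have t3 := term c a b Z X Y Z0 X0 Y0 hc la lb hZ.
apply: le_lt_trans (ler_normD _ _) _.
apply: le_lt_trans (lerD (ler_normB _ _) (lexx _)) _.
by lra.
Qed.

(* If K Q_(m-1) <= X <= Q_(m+1) / K, then a lies both in the plane of x_m, x_(m+1)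
   and in that of x_(m-1), x_m. *)
Lemma fibonacci_points_proportional xi x Q C D :
  fibonacci_points xi x Q C -> 0 < D ->
  exists X0, forall (a : 'M[int]_2) X, X0 <= X -> a 1 0 = a 0 1 ->
    `|(a 0 0)%:~R| <= D * X -> (forall j, `|linform xi a j| <= D / X) ->
    exists i, [/\ a 0 0 * x i 0 1 = a 0 1 * x i 0 0,
                  a 0 0 * x i 1 1 = a 1 1 * x i 0 0 &
                  a 0 1 * x i 1 1 = a 1 1 * x i 0 1].
Proof.
move=> fp D0; have C0 := fp_gt0 fp; have Q0 := fp_size_gt0 fp.
pose A := C + D; pose E := 8 * A ^+ 3.
have A0 : 0 < A by rewrite addr_gt0.
have E0 : 0 < E by rewrite mulr_gt0 // exprn_gt0.
pose K := E + C * E.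
have CE0 : 0 < C * E by rewrite mulr_gt0.
have K0 : 0 < K by rewrite addr_gt0.
pose B := 1 + E * K + C * E + C * C * E * K.
have [n hB] := fp_unbounded fp B.
exists (1 + Q n.+3 / K) => a X hX sa ha la.
have [X1 XQ] : 1 <= X /\ Q n.+3 <= K * X.
  have q0 : 0 < Q n.+3 / K by rewrite divr_gt0.
  by split; [lra|rewrite mulrC -ler_pdivrMr //; lra].
have X0 : 0 < X by lra.
have ex : exists r, K * X < Q (r + n.+3)%N.
  have [n' hn'] := fp_unbounded fp (K * X + 1).
  by exists n'; have := hn' _ (leq_addr n.+3 n'); lra.
(* The lower bound on [X] excludes the first index, so [K * X] lies between [Q l.+3] and [Q l.+4];
   the point sought is [x l.+3]. *)
case: (ex_minnP ex) => -[|r] hr rmin; first by move: hr; rewrite add0n; lra.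
have {}XQ : Q (r + n.+3)%N <= K * X.
  by rewrite leNgt; apply/negP => /rmin; rewrite ltnn.
move: hr XQ; rewrite addSn !addnS; set l := (r + n)%N => hr XQ.
have B0 i : (n <= i)%N ->
    [/\ 1 <= Q i, E * K <= Q i, C * E <= Q i & C * C * E * K <= Q i].
  move=> /hB; rewrite /B.
  have ? : 0 < E * K by rewrite mulr_gt0.
  have ? : 0 < C * C * E * K by rewrite !mulr_gt0.
  by move=> ?; split; lra.
have nl : (n <= l)%N by rewrite leq_addl.
have [l1 _ l3 l4] := B0 l.+1 (leqW nl).
have [m1 m2 m3 _] := B0 l.+2 (leqW (leqW nl)).
have [p1 _ _ _] := B0 l.+3 (leqW (leqW (leqW nl))).
have r1 := fp_mul_ge fp l.+1; have r2 := fp_mul_ge fp l.+2.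
have r3 := fp_mul_le fp l.+2.
have s2 := Q0 l.+2; have s3 := Q0 l.+3; have s4 := Q0 l.+4.
have c1 : E * Q l.+2 <= Q l.+3.
  rewrite -(ler_pM2l C0); apply: le_trans r1.
  by rewrite mulrA mulrC ler_pM2l.
have c4 : E * Q l.+3 <= Q l.+4.
  rewrite -(ler_pM2l C0); apply: le_trans r2.
  by rewrite mulrA mulrC ler_pM2l.
(* [k1] to [k3] are the size conditions of [det3_eq0] for the plane of [x l.+2] and [x l.+3], and
   [k4] to [k6] those for the next plane. *)
have k1 : E * Q l.+2 <= Q l.+3 * X by apply: le_trans c1 _; rewrite ler_peMr // ltW.
have k2 : E * Q l.+3 <= Q l.+2 * X.
  apply: le_trans (ler_wpM2l (ltW E0) XQ) _.
  by rewrite mulrA ler_pM2r.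
have k3 : E * X <= Q l.+2 * Q l.+3.
  rewrite -(ler_pM2l C0) [Q l.+2 * _]mulrC; apply: le_trans r3 => //.
  by apply: le_trans (ltW hr); rewrite mulrA ler_pM2r // /K lerDr ltW.
have k4 : E * Q l.+3 <= Q l.+4 * X by apply: le_trans c4 _; rewrite ler_peMr // ltW.
have k5 : E * Q l.+4 <= Q l.+3 * X.
  have hX2 : C * E * Q l.+2 <= X.
    rewrite -(ler_pM2l K0); apply: le_trans XQ.
    rewrite -(ler_pM2l C0); apply: le_trans r1.
    rewrite [leLHS](_ : _ = Q l.+2 * (C * C * E * K)); last by ring.
    by rewrite ler_pM2l.
  apply: le_trans (ler_wpM2l (ltW E0) r3) _.
  rewrite [leLHS](_ : _ = Q l.+3 * (C * E * Q l.+2)); last by ring.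
  by rewrite ler_pM2l.
have k6 : E * X <= Q l.+3 * Q l.+4.
  apply: le_trans (_ : Q l.+4 <= _); last by rewrite ler_peMl // ltW.
  by apply: le_trans (ltW hr); rewrite ler_pM2r // /K lerDl ltW.
have xA i : `|(x i 0 0)%:~R| <= A * Q i.
  by apply: le_trans (fp_le fp i) _; rewrite ler_pM2r // /A lerDl ltW.
have lA i j : `|linform xi (x i) j| <= A / Q i.
  by apply: le_trans (fp_approx fp i j) _; rewrite ler_pM2r ?invr_gt0 // /A lerDl ltW.
have aA : `|(a 0 0)%:~R| <= A * X.
  by apply: le_trans ha _; rewrite ler_pM2r // /A lerDr ltW.
have laA j : `|linform xi a j| <= A / X.
  by apply: le_trans (la j) _; rewrite ler_pM2r ?invr_gt0 // /A lerDr ltW.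
have sx := fp_sym fp.
have d1 : det3 (x l.+2) (x l.+3) a = 0.
  by apply: (@det3_eq0 xi _ _ _ A (Q l.+2) (Q l.+3) X).
have d2 : det3 (x l.+3) (x l.+4) a = 0.
  by apply: (@det3_eq0 xi _ _ _ A (Q l.+3) (Q l.+4) X).
have := fp_det3 fp l.+2; have := det3_proportional d2 d1 => /=.
move: (det3 _ _ _) => d [e1 e2 e3] d0.
have cancel z : d * z = 0 -> z = 0.
  by move/eqP; rewrite mulf_eq0 (negPf d0) => /eqP.
by exists l.+3; split; apply/eqP; rewrite -subr_eq0; apply/eqP/cancel.
Qed.
End Proportional.

(** * Points of an associated Fibonacci sequence *)

Section Associated.
Variable R : realType.

Local Notation g := (golden R).

Lemma normr_entry_le m n (A : 'M[R]_(m, n)) i j : `|A i j| <= `|A|.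
Proof.
rewrite [leRHS]/Num.Def.normr /= mx_normrE; apply/bigmax_geP; right => /=.
by exists (i, j).
Qed.

Lemma mxredK (A : 'M[int]_2) : (Defs.content A)%:Z *: mxred A = A.
Proof.
apply/matrixP => i j; rewrite !mxE mulrC divzK //.
by rewrite /dvdz /=; apply: (@biggcdn_inf _ (i, j)).
Qed.

(** With q_i = ln Y_i, the deviations q_(i+1) - g q_i are bounded, and g^2 = g + 1 writes q_(i+2) -
    q_(i+1) - q_i as a combination of two of them. *)
Lemma golden_growth_mul (Y : nat -> R) (c1 c2 : R) :
  (forall i, 0 < Y i) -> 0 < c1 -> 0 < c2 ->
  (forall i, c1 * Y i `^ g <= Y i.+1 <= c2 * Y i `^ g) ->
  (forall B, exists i, B < Y i) ->
  [/\ exists2 C, 0 < C & forall i, Y i.+2 <= C * (Y i.+1 * Y i) /\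
                                   Y i.+1 * Y i <= C * Y i.+2 &
      forall B, exists n, forall i, (n <= i)%N -> B <= Y i].
Proof.
move=> Y0 c10 c20 Yg Yoo.
pose q i := ln (Y i); pose M := `|ln c1| + `|ln c2|.
have /andP[g1 g2] := golden_bounds R; have gg := golden_eq R.
have M0 : 0 <= M by rewrite addr_ge0.
have hq i : - M <= q i.+1 - g * q i <= M.
  have /andP[h1 h2] := Yg i.
  have p0 : 0 < Y i `^ g by rewrite powR_gt0.
  have k1 : ln c1 + g * q i <= q i.+1.
    by rewrite -ln_powR -lnM ?posrE // ler_ln ?posrE ?mulr_gt0.
  have k2 : q i.+1 <= ln c2 + g * q i.
    by rewrite -ln_powR -lnM ?posrE // ler_ln ?posrE ?mulr_gt0.
  have := ler_norm (ln c2); have := ler_norm (- ln c1); rewrite normrN.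
  have := normr_ge0 (ln c1); have := normr_ge0 (ln c2).
  by rewrite /M => *; apply/andP; split; lra.
split.
  exists (expR (2 * M)) => [|i]; first exact: expR_gt0.
  have YE j : Y j = expR (q j) by rewrite lnK ?posrE.
  have /andP[h1 h2] := hq i; have /andP[h3 h4] := hq i.+1.
  have E : q i.+2 - q i.+1 - q i =
      (q i.+2 - g * q i.+1) + (g - 1) * (q i.+1 - g * q i).
    transitivity (q i.+2 - q i.+1 - q i + (g * g - (g + 1)) * - q i).
      by rewrite gg subrr mul0r addr0.
    by ring.
  move: E h1 h2 h3 h4; set a := q i.+1 - _; set b := q i.+2 - g * _ => E h1 h2 h3 h4.
  have k1 : (g - 1) * a <= M by nra.
  have k2 : - M <= (g - 1) * a by nra.
  by rewrite !YE -!expRD !ler_expR; split; lra.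
(* Beyond [M / (g - 1)] the sequence [q] no longer decreases, so a single large term bounds all
   later ones from below. *)
move=> B; pose T := `|B| + M / (g - 1).
have [n hn] := Yoo (expR T); exists n => i ni.
suff Ti : T <= q i.
  rewrite -[Y i]lnK ?posrE //; apply: le_trans (expR_ge1Dx _).
  apply: le_trans (ler_norm B) _.
  apply: le_trans (_ : T <= _); last by rewrite /q in Ti; lra.
  by rewrite /T lerDl divr_ge0 //; lra.
elim: i ni => [|i IH].
  rewrite leqn0 => /eqP n0; rewrite -[T]expRK ler_ln ?posrE ?expR_gt0 //.
  by rewrite -n0 ltW.
rewrite leq_eqVlt => /orP[/eqP n0|].
  by rewrite -[T]expRK ler_ln ?posrE ?expR_gt0 // -n0 ltW.
rewrite ltnS => /IH Ti; have /andP[h _] := hq i.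
have : M <= (g - 1) * q i.
  rewrite -ler_pdivrMl; last by lra.
  by apply: le_trans Ti; rewrite /T [_^-1 * _]mulrC lerDr.
by lra.
Qed.

Lemma linform_mulmx xi (A B : 'M[int]_2) j :
  linform xi (A *m B) j =
  linform xi A 0 * (B 0 j)%:~R + linform xi A 1 * (B 1 j)%:~R :> R.
Proof. by rewrite /linform !mulmx2E !rmorphD !rmorphM /=; ring. Qed.

Lemma mulmx_adj2 (N : 'M[int]_2) : N *m ((\tr N)%:M - N) = (\det N)%:M.
Proof.
have trN : \tr N = N 0 0 + N 1 1.
  rewrite /mxtrace !big_ord_recl big_ord0 addr0.
  by have -> : lift ord0 ord0 = 1 :> 'I_2 by apply/val_inj.
by apply: mx2P; rewrite mulmx2E !mxE /= det_mx2 trN; ring.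
Qed.

Lemma associated_fibonacci_points (W : nat -> 'M[int]_2) (eta : R) :
  associated W eta -> (forall i, W i \in unitmx) ->
  exists y Y C d, [/\ fibonacci_points eta y Y C, (0 < d)%N &
    forall i, absz (\det (y i)) = d].
Proof.
move=> [[Win Wfib] [N [[_ detN] Nsym _ WN]] [Yoo Yg Yrow _]] Wunit.
pose Ni i := if odd i then N^T else N.
pose Y i := norm_int_mx R (W i).
pose y i := W i *m Ni i.
have WY i a b : `|(W i a b)%:~R| <= Y i.
  by have := normr_entry_le (map_mx intr (W i) : 'M[R]_2) a b; rewrite mxE.
have detW i : absz (\det (W i)) = 1%N.
  by have := Wunit i; rewrite unitmxE => /orP[]/eqP ->.
have Y0 i : 0 < Y i.
  rewrite lt_neqAle eq_sym normr_ge0 andbT; apply/eqP => Yi.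
  have W0 a b : W i a b = 0.
    have := WY i a b; rewrite Yi normr_le0 intr_eq0.
    by move/eqP.
  by have := detW i; rewrite det_mx2 !W0 mul0r subr0.
have [c1 [c2 [c10 c20 hg]]] := Yg.
have [[C0 C00 YC] Yev] := golden_growth_mul Y0 c10 c20 hg Yoo.
have [b1 [b2 [_ b20 hr]]] := Yrow.
pose nu : R := `|map_mx intr N : 'M[R]_2|.
have nu0 : 0 <= nu := normr_ge0 _.
have Nnu i a b : `|(Ni i a b)%:~R| <= nu.
  rewrite /Ni; case: odd; rewrite ?mxE.
    by have := normr_entry_le (map_mx intr N : 'M[R]_2) b a; rewrite mxE.
  by have := normr_entry_le (map_mx intr N : 'M[R]_2) a b; rewrite mxE.
have Wrow i k : `|linform eta (W i) k| <= b2 / Y i.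
  have /andP[_] := hr i; apply: le_trans.
  by rewrite -approx_rowE normr_entry_le.
have nub0 : 0 <= 2 * nu * b2 by rewrite !mulr_ge0 // ltW.
pose C := C0 + 2 * nu + 2 * nu * b2.
have C0C : C0 <= C by rewrite /C; lra.
have ysym i : y i 1 0 = y i 0 1.
  by have /matrixP/(_ 0 1) := WN i; rewrite mxE.
have detNi i : \det (Ni i) = \det N by rewrite /Ni; case: odd; rewrite ?det_tr.
have dety i : absz (\det (y i)) = absz (\det N).
  by rewrite det_mulmx abszM detW mul1n detNi.
exists y, Y, C, (absz (\det N)); split => //; last by rewrite absz_gt0.
split => //.
- by rewrite /C; lra.
- move=> i; rewrite /y mulmx2E rmorphD !rmorphM /=.
  apply: le_trans (ler_normD _ _) _; rewrite !normrM.
  apply: le_trans (_ : Y i * nu + Y i * nu <= _).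
    by apply: lerD; apply: ler_pM.
  have : 0 <= (C0 + 2 * nu * b2) * Y i by rewrite mulr_ge0 // ?addr_ge0 // ltW.
  by rewrite /C; lra.
- move=> i j; rewrite /y linform_mulmx.
  apply: le_trans (ler_normD _ _) _; rewrite !normrM.
  have bY : 0 <= b2 / Y i by rewrite divr_ge0 // ltW.
  apply: le_trans (_ : b2 / Y i * nu + b2 / Y i * nu <= _).
    by apply: lerD; apply: ler_pM.
  rewrite [leLHS](_ : _ = 2 * nu * b2 / Y i); last by ring.
  by rewrite ler_pM2r ?invr_gt0 // /C; lra.
- move=> i; have [h _] := YC i; apply: le_trans h _.
  by rewrite ler_pM2r ?mulr_gt0.
- move=> i; have [_ h] := YC i; apply: le_trans h _.
  by rewrite ler_pM2r.
move=> i; pose gi := (Defs.content (W i.+1 *m W i))%:Z.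
have Wi : gi *: W i.+2 = W i.+1 *m W i by rewrite Wfib mxredK.
(* The adjugate of [Ni i.+1]: it turns [y i.+1] back into a multiple of [W i.+1], so the Fibonacci
   relation takes the form required by [det3_mul]. Its antisymmetric part is, up to sign, that of
   [N]. *)
pose K := (\tr (Ni i.+1))%:M - Ni i.+1.
have yi : (\det N * gi) *: y i.+2 = y i.+1 *m K *m y i.
  have -> : y i.+1 *m K = \det N *: W i.+1.
    by rewrite -mulmxA mulmx_adj2 detNi mul_mx_scalar.
  have NiSS : Ni i.+2 = Ni i by rewrite /Ni /= negbK.
  by rewrite /y NiSS -scalerA scalemxAl Wi -scalemxAl mulmxA.
have d0 j : \det (y j) != 0 by rewrite -absz_eq0 dety absz_eq0.
have K01 : K 1 0 - K 0 1 != 0.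
  have N01 : N 1 0 != N 0 1.
    by apply/eqP => h; apply: Nsym; apply: mx2P; rewrite mxE.
  rewrite /K !mxE /= !mulr0n !sub0r subr_eq0 eqr_opp /Ni.
  by case: odd; rewrite ?mxE // eq_sym.
have yKy : (y i.+1 *m K *m y i) 1 0 = (y i.+1 *m K *m y i) 0 1.
  by rewrite -yi [LHS]mxE [RHS]mxE ysym.
have := det3_mul (ysym i) (ysym i.+1) yKy; rewrite -yi => E.
apply/eqP => D0; have : \det (y i) * \det (y i.+1) * (K 1 0 - K 0 1) = 0.
  rewrite -E; transitivity ((\det N * gi) * det3 (y i) (y i.+1) (y i.+2)).
    by rewrite /det3 !mxE; ring.
  by rewrite D0 mulr0.
by move/eqP; rewrite !mulf_eq0 (negPf (d0 _)) (negPf (d0 _)) (negPf K01).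
Qed.
End Associated.

(** * Conjugation *)

(** The two sides would have 2-adic valuations of opposite parity. *)
Lemma double_square_eq0 (p q : nat) : (2 * p ^ 2 = q ^ 2)%N -> p = 0%N.
Proof.
have [->//|p0] := posnP p; have [->|q0] := posnP q => E; first by lia.
have := congr1 (fun n => odd (logn 2 n)) E.
by rewrite lognM ?expn_gt0 ?p0 // !lognX oddD !oddM (_ : logn 2 2 = 1%N).
Qed.

(** Determinants of proportional matrices of order 2 differ by the square of the ratio, here a
    quotient of corresponding entries. *)
Lemma proportional_det (a b : 'M[int]_2) :
  a 1 0 = a 0 1 -> b 1 0 = b 0 1 -> \det a != 0 -> \det b != 0 ->
  [/\ a 0 0 * b 0 1 = a 0 1 * b 0 0, a 0 0 * b 1 1 = a 1 1 * b 0 0 &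
      a 0 1 * b 1 1 = a 1 1 * b 0 1] ->
  exists u v, [/\ (0 < u)%N & (absz (\det a) * u ^ 2 = absz (\det b) * v ^ 2)%N].
Proof.
move=> sa sb; rewrite !det_mx2 sa sb => a0 b0 [e1 e2 e3].
suff [u [v [u0 E]]] : exists u v, u != 0 /\
    (a 0 0 * a 1 1 - a 0 1 * a 0 1) * u ^+ 2 =
    (b 0 0 * b 1 1 - b 0 1 * b 0 1) * v ^+ 2.
  exists (absz u), (absz v); rewrite absz_gt0; split=> //.
  by have := congr1 absz E; rewrite !expr2 !abszM !mulnn.
have [h0|h0] := eqVneq (b 0 0) 0.
  exists (b 0 1), (a 0 1); split.
    by apply: contra_neq b0 => ->; rewrite h0 !mul0r subrr.
  transitivity ((a 0 0 * b 0 1) * (a 1 1 * b 0 1) - (a 0 1 * b 0 1) ^+ 2).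
    by ring.
  by rewrite e1 -e3; ring.
exists (b 0 0), (a 0 0); split=> //.
transitivity (a 0 0 * b 0 0 * (a 1 1 * b 0 0) - (a 0 1 * b 0 0) ^+ 2); first by ring.
by rewrite -e1 -e2; ring.
Qed.

Lemma exists_int_multiple (A : 'M[rat]_2) : exists (k : int) (M : 'M[int]_2),
  k != 0 /\ forall i j, (M i j)%:~R = k%:~R * A i j.
Proof.
pose k : int := \prod_(ij : 'I_2 * 'I_2) denq (A ij.1 ij.2).
exists k, (\matrix_(i, j) ((k %/ denq (A i j))%Z * numq (A i j))); split.
  by apply/prodf_neq0 => ij _; exact: denq_neq0.
move=> i j; rewrite mxE -[A i j in RHS]divq_num_den.
have dk : (denq (A i j) %| k)%Z.
  by rewrite /k (bigD1 (i, j)) //= dvdz_mulr.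
rewrite -{2}(divzK dk) !intrM.
have : (denq (A i j))%:~R != 0 :> rat by rewrite intr_eq0 denq_neq0.
by move=> d0; field.
Qed.

Section Conjugation.
Variable R : realType.

(* (eta, -1) B is proportional to (xi, -1), so x |-> B x B^T carries good
   approximations of xi to good approximations of eta. *)
Lemma conjugation_mx (A : 'M[rat]_2) (xi : R) :
  A \in unitmx -> ~ Defs.rational xi ->
  exists (B : 'M[int]_2) (t : R), [/\ \det B != 0,
    linform (linear_fractional A xi) B 0 = t * xi &
    linform (linear_fractional A xi) B 1 = - t].
Proof.
rewrite unitmxE unitfE det_mx2 => dA nxi.
have [k [M [k0 MA]]] := exists_int_multiple A.
have MR i j : (M i j)%:~R = k%:~R * ratr (A i j) :> R.
  by rewrite -(ratr_int R (M i j)) MA rmorphM /= ratr_int.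
have den0 : ratr (A 1 0) * xi + ratr (A 1 1) != 0.
  apply/eqP => den; have [c0|c0] := eqVneq (A 1 0) 0.
    move: den dA; rewrite c0 rmorph0 mul0r add0r => /eqP.
    by rewrite fmorph_eq0 => /eqP ->; rewrite !mulr0 subrr eqxx.
  apply: nxi; exists (- A 1 1 / A 1 0).
  have cR : ratr (A 1 0) != 0 :> R by rewrite fmorph_eq0.
  apply: (mulfI cR); rewrite fmorph_div rmorphN /= mulrCA divff // mulr1.
  by apply/eqP; rewrite -addr_eq0 den.
(* [A] acts on (xi, 1) but points approximate multiples of (1, xi, xi^2), so both coordinates are
   exchanged. *)
exists (\matrix_(i, j) M (rev_ord i) (rev_ord j)),
  (k%:~R * (ratr (A 0 0) * ratr (A 1 1) - ratr (A 0 1) * ratr (A 1 0)) /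
    (ratr (A 1 0) * xi + ratr (A 1 1))).
have r0 : rev_ord (0 : 'I_2) = 1 by apply/val_inj.
have r1 : rev_ord (1 : 'I_2) = 0 by apply/val_inj.
rewrite det_mx2 /linform /linear_fractional !mxE r0 r1 !MR; split.
- rewrite -(intr_eq0 rat) rmorphB !rmorphM /= !MA.
  rewrite [X in X != 0](_ : _ =
    k%:~R ^+ 2 * (A 0 0 * A 1 1 - A 0 1 * A 1 0)); last by ring.
  by rewrite mulf_neq0 // expf_neq0 // intr_eq0.
- by field.
by field.
Qed.

Lemma conjugate_point_bounds xi eta C Q (B a : 'M[int]_2) (t : R) :
  linform eta B 0 = t * xi -> linform eta B 1 = - t ->
  a 1 0 = a 0 1 -> 0 < C -> 1 <= Q -> `|(a 0 0)%:~R| <= C * Q ->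
  (forall j, `|linform xi a j| <= C / Q) ->
  let b := `|map_mx intr B : 'M[R]_2| in
  `|((B *m a *m B^T) 0 0)%:~R| <= 4 * (b * b * ((`|xi| + 1) ^+ 2 * C)) * Q /\
  forall j, `|linform eta (B *m a *m B^T) j| <= 2 * (`|t| * C * b) / Q.
Proof.
move=> B0 B1 sa C0 Q1 a00 la b.
have Q0 : 0 < Q by lra.
have Bb i j : `|(B i j)%:~R : R| <= b.
  by have := normr_entry_le (map_mx intr B : 'M[R]_2) i j; rewrite mxE.
have b0 : 0 <= b := normr_ge0 _.
have CQ : C / Q <= C * Q.
  by rewrite ler_pM2l //; apply: (le_trans _ Q1); rewrite invf_le1.
have x0 : 0 <= `|xi| := normr_ge0 _.
have CQ0 : 0 <= C * Q by rewrite mulr_ge0 // ltW.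
(* Only the first entry of [a] is bounded by hypothesis; the others follow successively, each being
   xi times the previous one up to a small error. *)
have step (u v : int) j (p : R) : 0 <= p -> v%:~R = xi * u%:~R - linform xi a j ->
    `|u%:~R| <= p * (C * Q) -> `|v%:~R| <= (`|xi| * p + 1) * (C * Q).
  move=> p0 -> hu; apply: le_trans (ler_normB _ _) _.
  rewrite normrM mulrDl mul1r -mulrA; apply: lerD; first by apply: ler_wpM2l.
  exact: le_trans (la j) CQ.
have a01 : `|(a 0 1)%:~R| <= (`|xi| * 1 + 1) * (C * Q).
  apply: (step (a 0 0) _ 0) => //; last by rewrite mul1r.
  by rewrite /linform sa; ring.
have a11 : `|(a 1 1)%:~R| <= (`|xi| * (`|xi| * 1 + 1) + 1) * (C * Q).
  apply: (step _ _ 1 _ _ _ a01); last by rewrite /linform; ring.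
  by rewrite mulr1 addr_ge0.
split.
  have aP i j : `|(a i j)%:~R| <= (`|xi| + 1) ^+ 2 * (C * Q).
    have m1 : 1 <= (`|xi| + 1) ^+ 2 by nra.
    have m2 : `|xi| * 1 + 1 <= (`|xi| + 1) ^+ 2 by nra.
    have m3 : `|xi| * (`|xi| * 1 + 1) + 1 <= (`|xi| + 1) ^+ 2 by nra.
    case: (ord2P i) (ord2P j) => -> [] ->; rewrite ?sa.
    - by apply: le_trans a00 _; rewrite ler_peMl.
    - by apply: le_trans a01 _; rewrite ler_wpM2r.
    - by apply: le_trans a01 _; rewrite ler_wpM2r.
    by apply: le_trans a11 _; rewrite ler_wpM2r.
  have T i j : `|(B 0 i)%:~R * (a i j)%:~R * (B 0 j)%:~R| <=
      b * ((`|xi| + 1) ^+ 2 * (C * Q)) * b.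
    by rewrite !normrM; apply: ler_pM => //; apply: ler_pM.
  rewrite !mulmx2E !mxE !rmorphD !rmorphM /= !rmorphD !rmorphM /= !mulrDl.
  apply: le_trans (ler_normD _ _) _.
  apply: le_trans (lerD (ler_normD _ _) (ler_normD _ _)) _.
  by have := T 0 0; have := T 0 1; have := T 1 0; have := T 1 1; lra.
move=> j; have Bl k : linform eta (B *m a) k = t * linform xi a k.
  by rewrite linform_mulmx B0 B1 /linform; ring.
rewrite linform_mulmx !Bl !mxE.
have T k : `|t * linform xi a k * (B j k)%:~R| <= `|t| * (C / Q) * b.
  by rewrite !normrM; apply: ler_pM => //; apply: ler_wpM2l.
apply: le_trans (ler_normD _ _) _.
by have := T 0; have := T 1; lra.
Qed.

End Conjugation.

Theorem theorem2p4 (R : realType) :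
  exists xi : R,
    [/\ badly_approximable xi, extremal xi &
      forall eta : R,
        extremal eta ->
        (exists2 W : nat -> 'M[int]_2,
           associated W eta & forall i : nat, W i \in unitmx) ->
        ~ GL2Q_conjugate xi eta].
Proof.
have [xi [x [Q [C [bxi fp xdet]]]]] := exists_fibonacci_points R.
have exi := fibonacci_points_extremal bxi fp.
exists xi; split=> // eta _ [W Weta Wunit] [A uA etaE].
have [nxi _ _] := exi.
have [B [t [dB B0 B1]]] := conjugation_mx uA nxi.
rewrite -etaE in B0 B1.
have [y [Y [C' [d [fpy d0 ydet]]]]] := associated_fibonacci_points Weta Wunit.
have C0 := fp_gt0 fp.
pose b := `|map_mx intr B : 'M[R]_2|.
have b0 : 0 <= b := normr_ge0 _.
pose D1 := 4 * (b * b * ((`|xi| + 1) ^+ 2 * C)); pose D2 := 2 * (`|t| * C * b).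
have D10 : 0 <= D1 by rewrite !mulr_ge0 ?sqr_ge0 // ltW.
have D20 : 0 <= D2 by rewrite !mulr_ge0 // ltW.
(* [D1] bounds the sizes and [D2] the errors of the transported points; adding 1 makes the constant
   positive. *)
have [|X0 prop] := @fibonacci_points_proportional _ _ _ _ _ (D1 + D2 + 1) fpy.
  by lra.
have [n hn] := fp_unbounded fp (`|X0| + 1).
have [i ni dx] := xdet n.
have det0 j : j = i \/ j = i.+1 -> \det (x j) != 0.
  by move: dx => + [] ->; case: eqP => // ->; rewrite absz0 ?mul0n ?muln0.
have square j : j = i \/ j = i.+1 -> exists u v, (0 < u)%N /\
    (absz (\det B) ^ 2 * absz (\det (x j)) * u ^ 2 = d * v ^ 2)%N.
  move=> ij; have hQ : `|X0| + 1 <= Q j by apply: hn; case: ij => ->; lia.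
  have Q1 : 1 <= Q j by have := normr_ge0 X0; lra.
  have Q0 : 0 < Q j by lra.
  have [h1 h2] := conjugate_point_bounds B0 B1 (fp_sym fp j) C0 Q1
    (fp_le fp j) (fp_approx fp j).
  pose z := B *m x j *m B^T.
  have zsym : z 1 0 = z 0 1.
    by rewrite /z !mulmx2E !mxE (fp_sym fp j); ring.
  have Xj : X0 <= Q j by have := ler_norm X0; lra.
  have [||k hk] := prop z (Q j) Xj zsym.
  - by apply: le_trans h1 _; rewrite ler_pM2r //; rewrite -/b -/D1; lra.
  - move=> l; apply: le_trans (h2 l) _; rewrite ler_pM2r ?invr_gt0 //.
    by rewrite -/b -/D2; lra.
  have detz : \det z = \det B ^+ 2 * \det (x j).
    by rewrite /z !det_mulmx det_tr; ring.
  have [||u [v [u0 E]]] := proportional_det zsym (fp_sym fpy k) _ _ hk.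
  - by rewrite detz mulf_neq0 ?expf_neq0 ?det0.
  - by rewrite -absz_gt0 ydet.
  exists u, v; split=> //.
  by rewrite -(ydet k) -E detz abszM abszX.
have [u [v [u0 E]]] := square i (or_introl erefl).
have [u' [v' [u0' E']]] := square i.+1 (or_intror erefl).
(* In the product of the two relations [d] occurs squared, while the determinants of [x i] and
   [x i.+1] contribute the factor 2. *)
have : (2 * (absz (\det B) ^ 2 * u * u') ^ 2 = (d * v * v') ^ 2)%N.
  transitivity ((d * v ^ 2) * (d * v' ^ 2))%N; last by ring.
  transitivity (absz (\det (x i)) * absz (\det (x i.+1)) *
    (absz (\det B) ^ 2 * u * u') ^ 2)%N; first by rewrite dx.
  by rewrite -E -E'; ring.
move/double_square_eq0/eqP; apply/negP; rewrite -lt0n.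
by rewrite !(muln_gt0, expn_gt0, absz_gt0) dB u0 u0'.
Qed.
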